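(* Let $G=(\mathcal{M},\Psi,A)$ be a quantum graph with parameter $\delta$, and let $\Delta_L$ and $\Delta_R$ be its left and right Laplacians. Then for all $v$, $$2\Delta_L(v)=\delta^{-2}\left((A^\dagger 1)\cdot_{\mathrm{op}} v+v\cdot_{\mathrm{op}}(A1)-Av-A^\dagger v\right)$$ and $$2\Delta_R(v)=\delta^{-2}\left((A^\dagger 1)\, v+v\,(A1)-Av-A^\dagger v\right),$$ where $1$ is the unit of $\mathcal{M}$.
   Context: All $C^*$-algebras are finite-dimensional and unital. For a $C^*$-algebra $\mathcal{M}$ and a faithful positive functional $\Psi$ on $\mathcal{M}$, $L^2(\mathcal{M},\Psi)$ is the vector space $\mathcal{M}$ with inner product $\langle a,b\rangle_\Psi=\Psi(a^*b)$. The multiplication $m:L^2(\mathcal{M},\Psi)\otimes L^2(\mathcal{M},\Psi)\to L^2(\mathcal{M},\Psi)$, $m(a\otimes b)=ab$, has Hilbert space adjoint $m^\dagger$. $(\mathcal{M},\Psi)$ is a quantum system with parameter $\delta>0$ if $mm^\dagger=\delta^2\,\mathrm{id}$. The Schur product on $B(L^2(\mathcal{M},\Psi))$ is $M_1\cdot_S M_2=m(M_1\otimes M_2)m^\dagger$. Modular group: writing $\Psi(a)=\mathrm{Tr}(\rho a)$ with $\rho\in\mathcal{M}$ positive and invertible and $\mathrm{Tr}$ a faithful trace on $\mathcal{M}$, set $\sigma_z(a)=\rho^{iz}a\rho^{-iz}$ for $z\in\mathbb{C}$; it satisfies $\Psi(ab)=\Psi(b\,\sigma_{-i}(a))$. A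 quantum graph is a triple $(\mathcal{M},\Psi,A)$ where $(\mathcal{M},\Psi)$ is a quantum system with parameter $\delta$ and $A\in B(L^2(\mathcal{M},\Psi))$ satisfies $m(A\otimes A)m^\dagger=\delta^2A$, $A(x)^*=A(x^* )$ and $A^\dagger(x)^*=A^\dagger(x^* )$ for all $x$, where $\dagger$ is the adjoint on $L^2(\mathcal{M},\Psi)$. The opposite algebra $\mathcal{M}^{\mathrm{op}}$ is $\mathcal{M}$ as a vector space with the same involution and product $a\cdot_{\mathrm{op}}b=ba$. Define $\pi(a)b=ab$ for $a\in\mathcal{M}$ and $\pi^{\mathrm{op}}(a)b=b\,\sigma_{-i/2}(a)$ for $a\in\mathcal{M}^{\mathrm{op}}$, both acting on $b\in L^2(\mathcal{M},\Psi)$. The left and right scalar products on $B(L^2(\mathcal{M},\Psi))$ are $\langle X,Y\rangle_L=\mathrm{Tr}((\sigma_i\circ X)^\dagger Y)$ and $\langle X,Y\rangle_R=\mathrm{Tr}((X\circ\sigma_{-i})^\dagger Y)$ ($\mathrm{Tr}$ here is the operator trace). The left and right edge spaces are $S_L(G)=\{\delta^{-2}A\cdot_S X: X\in B(L^2(\mathcal{M},\Psi))\}$ and $S_R(G)=\{\delta^{-2}X\cdot_S A: X\in B(L^2(\mathcal{M},\Psi))\}$. The incidence operators $\mathcal{K}_L:\mathcal{M}^{\mathrm{op}}\to S_L(G)$ and $\mathcal{K}_R:\mathcal{M}\to S_R(G)$ are $$\mathcal{K}_L(a)=\delta^{-2}(\pi^{\mathrm{op}}(a)A-A\pi^{\mathrm{op}}(a)),\qquad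 \mathcal{K}_R(a)=\delta^{-2}(\pi(a)A-A\pi(a)).$$ The Laplacians are $\Delta_L=\tfrac12\mathcal{K}_L^{\dagger_L}\mathcal{K}_L:\mathcal{M}^{\mathrm{op}}\to\mathcal{M}^{\mathrm{op}}$ and $\Delta_R=\tfrac12\mathcal{K}_R^{\dagger_R}\mathcal{K}_R:\mathcal{M}\to\mathcal{M}$, where $\dagger_L$ (resp. $\dagger_R$) is the adjoint with respect to $\langle\cdot,\cdot\rangle_L$ on $S_L(G)$ (resp. $\langle\cdot,\cdot\rangle_R$ on $S_R(G)$) and $\langle\cdot,\cdot\rangle_\Psi$ on the underlying vector space $\mathcal{M}$ of the domain. *)

(* Defs.v *)
From HB Require Import structures.
From mathcomp Require Import all_boot all_order all_algebra all_field.
From mathcomp Require Import finmap complex ring.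
From mathcomp Require Import all_classical all_reals all_analysis.

Set Implicit Arguments.
Unset Strict Implicit.
Unset Printing Implicit Defensive.

Import Order.TTheory GRing.Theory Num.Theory.
Local Open Scope ring_scope.

(* Finite-dimensional unital C*-algebras, meant for C = Cplx R below; the
   algebraic part of the theory does not depend on R.  Completeness of the norm
   is automatic in finite dimension over Cplx R. *)
Record cstarAlgType (C : numClosedFieldType) := CstarAlgType {
  cstar_sort :> falgType C;
  star : cstar_sort -> cstar_sort;
  cnorm : cstar_sort -> C;
  starK : involutive star;
  star_conj_linear : forall (c : C) a b,
    star (c *: a + b) = Num.conj c *: star a + star b;
  starM : forall a b, star (a * b) = star b * star a;
  cnorm_ge0 : forall a, 0 <= cnorm a;
  cnorm_eq0 : forall a, cnorm a = 0 -> a = 0;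
  cnormD : forall a b, cnorm (a + b) <= cnorm a + cnorm b;
  cnormZ : forall (c : C) a, cnorm (c *: a) = `|c| * cnorm a;
  cnormM : forall a b, cnorm (a * b) <= cnorm a * cnorm b;
  cnorm_star : forall a, cnorm (star a * a) = cnorm a ^+ 2
}.

(* f^dagger for f : U -> V and inner products ipU, ipV (conjugate-linear in the
   first argument): the unique g with <f u, v> = <u, g v>; see adjointP. *)
Definition adjoint (K : fieldType) (U V : vectType K)
    (ipU : U -> U -> K) (ipV : V -> V -> K) (f : 'Hom(U, V)) : 'Hom(V, U) :=
  xget 0 [set g : 'Hom(V, U) | forall u v, ipV (f u) v = ipU u (g v)]%classic.

Lemma linfun_linear (K : fieldType) (U V : vectType K) (f : U -> V) :
  linear f -> linfun f =1 f.
Proof.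
move=> lf u.
pose F : {linear U -> V} := HB.pack f (GRing.isLinear.Build K U V *:%R f lf).
exact: (lfunE F u).
Qed.

(* U \otimes V is modelled by matrices of coordinates in the distinguished bases
   vbasis {:U} and vbasis {:V}. *)
Section Tensor.
Variable K : fieldType.

Definition vbase (U : vectType K) (i : 'I_(\dim {:U})) : U :=
  tnth (vbasis {:U}) i.
Definition vcoord (U : vectType K) (i : 'I_(\dim {:U})) (u : U) : K :=
  coord (vbasis {:U}) i u.

Definition lftrace (U : vectType K) (f : 'End(U)) : K :=
  \sum_i vcoord i (f (vbase i)).

Definition tensor (U V : vectType K) : Type := 'M[K]_(\dim {:U}, \dim {:V}).

HB.instance Definition _ (U V : vectType K) :=
  Vector.copy (tensor U V) 'M[K]_(\dim {:U}, \dim {:V}).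

Definition tcoord (U V : vectType K) (t : tensor U V) : 'M[K]_(_, _) := t.

Definition tens (U V : vectType K) (u : U) (v : V) : tensor U V :=
  \matrix_(i, j) (vcoord i u * vcoord j v).

(* The linear map out of the tensor product induced by a bilinear map f;
   see tlift_tens. *)
Definition tlift (U V W : vectType K) (f : U -> V -> W) : 'Hom(tensor U V, W) :=
  linfun (fun t : tensor U V =>
            \sum_i \sum_j tcoord t i j *: f (vbase i) (vbase j)).

Definition tmap (U V U' V' : vectType K) (X : 'Hom(U, U')) (Y : 'Hom(V, V')) :
    'Hom(tensor U V, tensor U' V') :=
  tlift (fun u v => tens (X u) (Y v)).

Lemma vcoordK (U : vectType K) (u : U) : u = \sum_i vcoord i u *: vbase i.
Proof.
rewrite {1}(coord_vbasis (memvf u)); apply: eq_bigr => i _.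
by rewrite /vbase (tnth_nth 0).
Qed.

Lemma vcoord_base (U : vectType K) (i j : 'I_(\dim {:U})) :
  vcoord i (vbase j) = (i == j)%:R.
Proof.
by rewrite /vcoord /vbase (tnth_nth 0) coord_free ?(basis_free (vbasisP _)) // eq_sym.
Qed.

Lemma vcoord_sum (U : vectType K) (k : 'I_(\dim {:U})) (c : 'I_(\dim {:U}) -> K) :
  vcoord k (\sum_i c i *: vbase i) = c k.
Proof.
rewrite {1}/vcoord linear_sum (bigD1 k) //= linearZ /= -/(vcoord k _).
rewrite vcoord_base eqxx big1 => [|i ik]; first by rewrite addr0 /GRing.scale /= mulr1.
by rewrite linearZ /= -/(vcoord k _) vcoord_base eq_sym (negPf ik) /GRing.scale /= mulr0.
Qed.

Lemma tlift_is_linear (U V W : vectType K) (f : U -> V -> W) :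
  linear (fun t : tensor U V =>
            \sum_i \sum_j tcoord t i j *: f (vbase i) (vbase j)).
Proof.
move=> c s t; rewrite scaler_sumr -big_split; apply: eq_bigr => i _ /=.
rewrite scaler_sumr -big_split; apply: eq_bigr => j _ /=.
by rewrite scalerA -scalerDl; congr (_ *: _); rewrite /tcoord !mxE.
Qed.

Lemma tliftE (U V W : vectType K) (f : U -> V -> W) (t : tensor U V) :
  tlift f t = \sum_i \sum_j tcoord t i j *: f (vbase i) (vbase j).
Proof. by rewrite /tlift (linfun_linear (tlift_is_linear f)). Qed.

Definition bilin (U V W : vectType K) (f : U -> V -> W) : Prop :=
  (forall v, linear (f^~ v)) /\ (forall u, linear (f u)).

Lemma linear_sumE (U V : vectType K) (f : U -> V) (I : finType)
    (c : I -> K) (x : I -> U) :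
  linear f -> f (\sum_i c i *: x i) = \sum_i c i *: f (x i).
Proof.
move=> lf.
pose F : {linear U -> V} := HB.pack f (GRing.isLinear.Build K U V *:%R f lf).
rewrite -[f]/(F : U -> V) linear_sum; apply: eq_bigr => i _.
by rewrite linearZ.
Qed.

Lemma linear_sum1E (U V : vectType K) (f : U -> V) (I : finType) (x : I -> U) :
  linear f -> f (\sum_i x i) = \sum_i f (x i).
Proof.
move=> lf; have := linear_sumE (fun=> 1) x lf.
by under eq_bigr do rewrite scale1r; under [RHS]eq_bigr do rewrite scale1r.
Qed.

Lemma tlift_tens (U V W : vectType K) (f : U -> V -> W) u v :
  bilin f -> tlift f (tens u v) = f u v.
Proof.
move=> [fl fr]; rewrite tliftE [in RHS](vcoordK u) (linear_sumE _ _ (fl v)).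
apply: eq_bigr => i _; rewrite [in RHS](vcoordK v) (linear_sumE _ _ (fr _)).
rewrite scaler_sumr; apply: eq_bigr => j _.
by rewrite scalerA /tcoord mxE.
Qed.

Lemma tens_bilin (U V : vectType K) : bilin (@tens U V).
Proof.
by split=> x c a b; apply/matrixP=> i j; rewrite !mxE /vcoord linearP;
  rewrite ?mulrDl ?mulrDr ?mulrA // -!mulrA; congr (_ + _); rewrite mulrCA.
Qed.

Lemma tensK (U V : vectType K) (t : tensor U V) :
  t = \sum_i \sum_j tcoord t i j *: tens (vbase i) (vbase j).
Proof.
apply/matrixP=> k l; rewrite summxE (bigD1 k) //= summxE (bigD1 l) //=.
rewrite !mxE !vcoord_base !eqxx !mulr1 big1 ?addr0 => [|j jl]; last first.
  by rewrite !mxE !vcoord_base [l == j]eq_sym (negPf jl) !mulr0.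
rewrite big1 ?addr0 // => i ik; rewrite summxE big1 // => j _.
by rewrite !mxE !vcoord_base [k == i]eq_sym (negPf ik) mul0r mulr0.
Qed.

Lemma tensor_extf (U V W : vectType K) (f g : tensor U V -> W) :
  linear f -> linear g -> (forall u v, f (tens u v) = g (tens u v)) -> f =1 g.
Proof.
move=> lf lg fg t; rewrite (tensK t) !(linear_sum1E _ lf) !(linear_sum1E _ lg).
apply: eq_bigr => i _; rewrite (linear_sumE _ _ lf) (linear_sumE _ _ lg).
by apply: eq_bigr => j _; rewrite fg.
Qed.

Lemma tensor_ext (U V W : vectType K) (f g : 'Hom(tensor U V, W)) :
  (forall u v, f (tens u v) = g (tens u v)) -> f = g.
Proof.
move=> fg; apply/lfunP=> t; rewrite (tensK t) !linear_sum.
apply: eq_bigr => i _; rewrite !linear_sum; apply: eq_bigr => j _.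
by rewrite !linearZ /= fg.
Qed.

Lemma tmap_tens (U V U' V' : vectType K) (X : 'Hom(U, U')) (Y : 'Hom(V, V'))
    u v : tmap X Y (tens u v) = tens (X u) (Y v).
Proof.
rewrite /tmap tlift_tens //; split=> x c a b.
  by rewrite linearP (tens_bilin _ _).1.
by rewrite linearP (tens_bilin _ _).2.
Qed.

End Tensor.

Section Adjoint.
Variable C : numClosedFieldType.

Record nondegenerate_hermitian (U : vectType C) (h : U -> U -> C) : Prop :=
  NondegenerateHermitian {
    herm_linear : forall u c v w, h u (c *: v + w) = c * h u v + h u w;
    herm_conj : forall u v, h v u = Num.conj (h u v);
    herm_nondeg : forall w, (forall u, h u w = 0) -> w = 0
  }.

Section Form.
Variables (U : vectType C) (h : U -> U -> C).
Hypothesis hP : nondegenerate_hermitian h.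

Lemma herm_linear_r u : linear (h u : U -> C^o).
Proof. by move=> c v w; rewrite (herm_linear hP). Qed.

Lemma herm_sumr (I : finType) (c : I -> C) (x : I -> U) u :
  h u (\sum_i c i *: x i) = \sum_i c i * h u (x i).
Proof. exact: (linear_sumE _ _ (herm_linear_r u)). Qed.

Lemma herm_suml (I : finType) (c : I -> C) (x : I -> U) u :
  h (\sum_i c i *: x i) u = \sum_i Num.conj (c i) * h (x i) u.
Proof.
rewrite (herm_conj hP) herm_sumr rmorph_sum; apply: eq_bigr => i _.
by rewrite rmorphM /= -(herm_conj hP).
Qed.

Lemma herm_inj v w : (forall u, h u v = h u w) -> v = w.
Proof.
move=> e; apply/eqP; rewrite -subr_eq0; apply/eqP/(herm_nondeg hP) => u.
by rewrite addrC -scaleN1r (herm_linear hP) e mulN1r addNr.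
Qed.

Lemma herm_riesz (b : 'I_(\dim {:U}) -> C) :
  {w : U | forall i, h (vbase i) w = b i}.
Proof.
pose L (w : U) : {ffun 'I_(\dim {:U}) -> C^o} := [ffun i => h (vbase i) w : C^o].
have lL : linear L by move=> c v w; apply/ffunP=> i; rewrite !ffunE (herm_linear hP).
pose F := linfun L.
have kF : lker F == 0%VS.
  rewrite -subv0; apply/subvP=> w; rewrite memv_ker memv0 linfun_linear // => /eqP Lw.
  apply/eqP/(herm_nondeg hP) => u; rewrite (vcoordK u) herm_suml big1 // => i _.
  by have := congr1 (fun f : {ffun _ -> _} => f i) Lw; rewrite !ffunE => ->; rewrite mulr0.
have iF : limg F = fullv.
  apply/eqP; rewrite eqEdim subvf limg_dim_eq; last by rewrite (eqP kF) capv0.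
  by rewrite [leqLHS]dimvf [leqLHS]/dim /= card_ord muln1.
exists ((F^-1)%VF [ffun i => b i : C^o]) => i.
have : F ((F^-1)%VF [ffun i => b i : C^o]) = [ffun i => b i : C^o].
  by apply: limg_lfunVK; rewrite iF memvf.
by rewrite {1}/F linfun_linear // => /(congr1 (fun f : {ffun _ -> _} => f i)); rewrite !ffunE.
Qed.

End Form.

Lemma adjointP (U V : vectType C) (hU : U -> U -> C) (hV : V -> V -> C)
    (f : 'Hom(U, V)) u v :
  nondegenerate_hermitian hU -> nondegenerate_hermitian hV ->
  hV (f u) v = hU u (adjoint hU hV f v).
Proof.
move=> UP VP; rewrite /adjoint; case: xgetP => [g _ -> //|noadj].
pose g v := sval (herm_riesz UP (fun i => hV (f (vbase i)) v)).
have gP x y : hV (f x) y = hU x (g y).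
  rewrite (vcoordK x) linear_sum (herm_suml UP).
  under eq_bigr do rewrite linearZ.
  rewrite (herm_suml VP); apply: eq_bigr => i _; congr (_ * _).
  by rewrite /g; case: (herm_riesz _ _) => w /= ->.
have lg : linear g.
  move=> c x y; apply: (herm_inj UP) => z.
  by rewrite (herm_linear UP) -!gP (herm_linear VP).
by case: (noadj (linfun g)) => x y; rewrite linfun_linear // gP.
Qed.

Lemma adjoint_unique (U V : vectType C) (hU : U -> U -> C) (hV : V -> V -> C)
    (f : 'Hom(U, V)) (g : 'Hom(V, U)) :
  nondegenerate_hermitian hU -> nondegenerate_hermitian hV ->
  (forall u v, hV (f u) v = hU u (g v)) -> adjoint hU hV f = g.
Proof.
move=> UP VP fg; apply/lfunP=> v; apply: (herm_inj UP) => u.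
by rewrite -adjointP.
Qed.

End Adjoint.

(* <a \otimes b, c \otimes d> = <a, c> <b, d>, see tensor_ip_tens. *)
Definition tensor_ip (C : numClosedFieldType) (U V : vectType C)
    (ipU : U -> U -> C) (ipV : V -> V -> C) (s t : tensor U V) : C :=
  \sum_i \sum_j \sum_k \sum_l
    Num.conj (tcoord s i j) * tcoord t k l
    * (ipU (vbase i) (vbase k) * ipV (vbase j) (vbase l)).

Section Functionals.
Variables (C : numClosedFieldType) (M : cstarAlgType C).

Definition positive_elt (a : M) : Prop := exists b : M, a = star b * b.

Definition faithful_positive (Psi : {scalar M}) : Prop :=
  (forall a : M, 0 <= Psi (star a * a)) /\
  (forall a : M, Psi (star a * a) = 0 -> a = 0).

Definition faithful_trace (tau : {scalar M}) : Prop :=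
  faithful_positive tau /\ (forall a b : M, tau (a * b) = tau (b * a)).

Definition ip (Psi : {scalar M}) (a b : M) : C := Psi (star a * b).

Definition mult : 'Hom(tensor M M, M) := tlift (fun a b : M => a * b).

Definition dag (Psi : {scalar M}) (X : 'End(M)) : 'End(M) :=
  adjoint (ip Psi) (ip Psi) X.

Definition mult_dag (Psi : {scalar M}) : 'Hom(M, tensor M M) :=
  adjoint (tensor_ip (ip Psi) (ip Psi)) (ip Psi) mult.

Definition schur (Psi : {scalar M}) (X Y : 'End(M)) : 'End(M) :=
  (mult \o (tmap X Y \o mult_dag Psi))%VF.

Record quantum_system (Psi : {scalar M}) (delta : C) : Prop := QuantumSystem {
  qs_delta_gt0 : 0 < delta;
  qs_faithful : faithful_positive Psi;
  qs_mult : (mult \o mult_dag Psi)%VF = (delta ^+ 2) *: \1%VF :> 'End(M)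
}.

Record quantum_graph (Psi : {scalar M}) (delta : C) (A : 'End(M)) : Prop :=
  QuantumGraph {
    qg_system : quantum_system Psi delta;
    qg_schur : schur Psi A A = (delta ^+ 2) *: A;
    qg_real : forall x : M, star (A x) = A (star x);
    qg_dag_real : forall x : M, star (dag Psi A x) = dag Psi A (star x)
  }.

(* rho is the density of Psi with respect to the faithful trace tau. *)
Definition density (Psi tau : {scalar M}) (rho : M) : Prop :=
  [/\ faithful_trace tau, positive_elt rho, rho \is a GRing.unit &
      forall a : M, Psi a = tau (rho * a)].

(* M^op has the vector space, involution and inner product of M, so only its
   product is needed. *)
Definition op_mul (a b : M) : M := (a : M^c) * (b : M^c).

End Functionals.

Section TensorForm.
Variables (C : numClosedFieldType) (U V : vectType C).
Variables (hU : U -> U -> C) (hV : V -> V -> C).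
Hypotheses (UP : nondegenerate_hermitian hU) (VP : nondegenerate_hermitian hV).

Lemma tensor_ip_tens a b c d :
  tensor_ip hU hV (tens a b) (tens c d) = hU a c * hV b d.
Proof.
rewrite /tensor_ip [in RHS](vcoordK a) (herm_suml UP) mulr_suml.
apply: eq_bigr => i _; rewrite [in RHS](vcoordK b) (herm_suml VP) mulr_sumr.
apply: eq_bigr => j _; rewrite [in RHS](vcoordK c) (herm_sumr UP).
rewrite mulr_sumr mulr_suml; apply: eq_bigr => k _.
rewrite [in RHS](vcoordK d) (herm_sumr VP) !mulr_sumr; apply: eq_bigr => l _.
by rewrite /tcoord !mxE rmorphM /=; ring.
Qed.

Lemma tensor_ip_herm : nondegenerate_hermitian (tensor_ip hU hV).
Proof.
have lin s c t t' : tensor_ip hU hV s (c *: t + t')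
    = c * tensor_ip hU hV s t + tensor_ip hU hV s t'.
  rewrite /tensor_ip mulr_sumr -big_split; apply: eq_bigr => i _ /=.
  rewrite mulr_sumr -big_split; apply: eq_bigr => j _ /=.
  rewrite mulr_sumr -big_split; apply: eq_bigr => k _ /=.
  rewrite mulr_sumr -big_split; apply: eq_bigr => l _ /=.
  by rewrite /tcoord !mxE; ring.
split=> // [s t|t t0].
  rewrite /tensor_ip !rmorph_sum.
  under [RHS]eq_bigr do rewrite rmorph_sum.
  under [RHS]eq_bigr do under eq_bigr do rewrite rmorph_sum.
  under [RHS]eq_bigr do under eq_bigr do under eq_bigr do rewrite rmorph_sum.
  pose E i j k l := Num.conj (tcoord t i j) * tcoord s k l
      * (hU (vbase i) (vbase k) * hV (vbase j) (vbase l)).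
  transitivity (\sum_i \sum_k \sum_j \sum_l E i j k l).
    by apply: eq_bigr => i _; rewrite exchange_big.
  rewrite exchange_big; apply: eq_bigr => k _ /=.
  transitivity (\sum_i \sum_l \sum_j E i j k l).
    by apply: eq_bigr => i _; rewrite exchange_big.
  rewrite exchange_big; apply: eq_bigr => l _ /=.
  apply: eq_bigr => i _; apply: eq_bigr => j _.
  rewrite /E !rmorphM /= conjCK [in LHS]mulrC [in RHS]mulrC; congr (_ * _).
    by rewrite -(herm_conj UP) -(herm_conj VP).
  by rewrite mulrC.
have pair a b : tensor_ip hU hV (tens a b) t
    = hU a (\sum_k hV b (\sum_l tcoord t k l *: vbase l) *: vbase k).
  rewrite [in LHS](tensK t).
  have ls c w w' : tensor_ip hU hV (tens a b) (c *: w + w')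
    = c * tensor_ip hU hV (tens a b) w + tensor_ip hU hV (tens a b) w' by [].
  pose L : tensor U V -> C^o := tensor_ip hU hV (tens a b).
  have lL : linear L by exact: ls.
  rewrite -/(L _).
  rewrite (herm_sumr UP).
  transitivity (\sum_k L (\sum_l tcoord t k l *: tens (vbase k) (vbase l))).
    exact: (linear_sum1E _ lL).
  apply: eq_bigr => k _; rewrite (linear_sumE _ _ lL) (herm_sumr VP) mulr_suml.
  by apply: eq_bigr => l _; rewrite /L tensor_ip_tens -mulrA [_ * hV _ _]mulrC.
have h0 b : \sum_k hV b (\sum_l tcoord t k l *: vbase l) *: vbase k = 0 :> U.
  by apply: (herm_nondeg UP) => a; rewrite -pair.
have c0 k : \sum_l tcoord t k l *: vbase l = 0 :> V.
  apply: (herm_nondeg VP) => b.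
  by rewrite -(vcoord_sum k (fun k => hV b (\sum_l tcoord t k l *: vbase l))) h0 /vcoord linear0.
apply/matrixP=> k l; rewrite mxE.
by rewrite -[LHS](vcoord_sum l (fun l => tcoord t k l)) c0 /vcoord linear0.
Qed.

(* Adjoint pairs of factors give adjoint pairs on the tensor product. *)
Lemma tmap_adj (X X' : 'End(U)) (Y Y' : 'End(V)) s t :
  (forall a b, hU a (X b) = hU (X' a) b) ->
  (forall a b, hV a (Y b) = hV (Y' a) b) ->
  tensor_ip hU hV s (tmap X Y t) = tensor_ip hU hV (tmap X' Y' s) t.
Proof.
move=> XX YY; have TP := tensor_ip_herm.
rewrite (herm_conj TP) [RHS](herm_conj TP); congr Num.conj.
pose f s : C^o := tensor_ip hU hV (tmap X Y t) s.
pose g s : C^o := tensor_ip hU hV t (tmap X' Y' s).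
apply: (@tensor_extf _ _ _ _ f g); rewrite /f /g => {f g}.
- by move=> c x y; rewrite (herm_linear TP).
- by move=> c x y; rewrite linearP (herm_linear TP).
move=> a b; rewrite (herm_conj TP) [RHS](herm_conj TP); congr Num.conj.
pose f t : C^o := tensor_ip hU hV (tens a b) (tmap X Y t).
pose g t : C^o := tensor_ip hU hV (tmap X' Y' (tens a b)) t.
apply: (@tensor_extf _ _ _ _ f g); rewrite /f /g => {f g}.
- by move=> c x y; rewrite linearP (herm_linear TP).
- by move=> c x y; rewrite (herm_linear TP).
by move=> c d; rewrite !tmap_tens !tensor_ip_tens XX YY.
Qed.

End TensorForm.

Section CStarForm.
Variables (C : numClosedFieldType) (M : cstarAlgType C) (Psi : {scalar M}).
Hypothesis PsiP : faithful_positive Psi.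

Lemma ip_herm : nondegenerate_hermitian (ip Psi).
Proof.
have lr (a : M) c b d : ip Psi a (c *: b + d) = c * ip Psi a b + ip Psi a d.
  by rewrite /ip mulrDr -scalerAr linearP.
have ll (a b d : M) c : ip Psi (c *: a + d) b = Num.conj c * ip Psi a b + ip Psi d b.
  by rewrite /ip star_conj_linear mulrDl -scalerAl linearP.
have re (a : M) : Num.conj (ip Psi a a) = ip Psi a a.
  by apply/CrealP/ger0_real/(PsiP.1 a).
split=> // [a b|a a0]; last by apply: PsiP.2; apply: a0.
have reD (x y : C) : Num.conj (x + y) = x + y -> Num.conj ('i * (x - y)) = 'i * (x - y) -> y = Num.conj x.
  rewrite !rmorphM !rmorphD !rmorphN /= conjCi mulNr => e1 e2.
  have {}e2 : Num.conj x - Num.conj y = y - x.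
    by apply: (mulfI (neq0Ci _)); rewrite -[LHS]opprK e2 -mulrN opprB.
  have e3 : 2 * Num.conj x = 2 * y.
    transitivity ((Num.conj x + Num.conj y) + (Num.conj x - Num.conj y)); first by ring.
    by rewrite e1 e2; ring.
  by apply: (mulfI _ (esym e3)); rewrite pnatr_eq0.
have canc (x y : C) : Num.conj y = y -> Num.conj (x + y) = x + y -> Num.conj x = x.
  by move=> ey; rewrite rmorphD /= ey => /addIr.
apply: reD.
  have := re (1 *: a + b); rewrite !(lr, ll) !mul1r rmorph1 !mul1r.
  have -> : ip Psi a a + ip Psi b a + (ip Psi a b + ip Psi b b) = (ip Psi a b + ip Psi b a) + (ip Psi a a + ip Psi b b) by ring.
  by apply: canc; rewrite rmorphD /= !re.
have := re ('i *: b + a); rewrite !(lr, ll) conjCi.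
have -> : 'i * (- 'i * ip Psi b b + ip Psi a b) + (- 'i * ip Psi b a + ip Psi a a)
   = 'i * (ip Psi a b - ip Psi b a) + (ip Psi b b * (- ('i * 'i)) + ip Psi a a) by ring.
rewrite -expr2 sqrCi opprK mulr1.
by apply: canc; rewrite rmorphD /= !re.
Qed.

Let IP := ip_herm.
Let TP := tensor_ip_herm IP IP.

Lemma mult_tens (a b : M) : mult M (tens a b) = a * b.
Proof.
rewrite /mult tlift_tens //; split=> x c y z.
  by rewrite mulrDl -scalerAl.
by rewrite mulrDr -scalerAr.
Qed.

Lemma mult_dagP s (b : M) :
  ip Psi (mult M s) b = tensor_ip (ip Psi) (ip Psi) s (mult_dag Psi b).
Proof. exact: (adjointP _ _ _ TP IP). Qed.

Lemma dagP (X : 'End(M)) (a b : M) : ip Psi (X a) b = ip Psi a (dag Psi X b).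
Proof. exact: (adjointP _ _ _ IP IP). Qed.

Lemma dagP' (X : 'End(M)) (a b : M) : ip Psi a (X b) = ip Psi (dag Psi X a) b.
Proof. by rewrite (herm_conj IP) dagP -(herm_conj IP). Qed.

Lemma mult_dag_l (a b : M) :
  mult_dag Psi (a * b) = tmap (amull a) \1%VF (mult_dag Psi b).
Proof.
apply: (herm_inj TP) => s; rewrite -mult_dagP.
rewrite (tmap_adj (X' := amull (star a)) (Y' := \1%VF) IP IP); first last.
- by move=> x y; rewrite !lfunE.
- by move=> x y; rewrite !lfunE /= /ip starM starK mulrA.
rewrite -mult_dagP.
have -> : mult M (tmap (amull (star a)) \1%VF s) = amull (star a) (mult M s).
  rewrite -!comp_lfunE; congr (fun_of_lfun _ s); apply: tensor_ext => x y.
  by rewrite !comp_lfunE tmap_tens !mult_tens !lfunE /= mulrA.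
rewrite lfunE /=.
by rewrite /ip starM starK mulrA.
Qed.

Lemma mult_dag_r (c b : M) :
  mult_dag Psi (b * c) = tmap \1%VF (amulr c) (mult_dag Psi b).
Proof.
pose D := dag Psi (amulr c).
have DM x y : D (x * y) = x * D y.
  apply: (herm_inj IP) => z; rewrite -dagP !lfunE /=.
  have -> : ip Psi z (x * D y) = ip Psi (star x * z) (D y).
    by rewrite /ip starM starK mulrA.
  by rewrite -dagP !lfunE /= /ip !starM starK !mulrA.
apply: (herm_inj TP) => s; rewrite -mult_dagP.
rewrite (tmap_adj (X' := \1%VF) (Y' := D) IP IP); first last.
- exact: dagP'.
- by move=> x y; rewrite !lfunE.
rewrite -mult_dagP.
have -> : mult M (tmap \1%VF D s) = D (mult M s).
  rewrite -!comp_lfunE; congr (fun_of_lfun _ s); apply: tensor_ext => x y.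
  by rewrite !comp_lfunE tmap_tens !mult_tens DM !lfunE.
by rewrite -dagP' lfunE.
Qed.

Lemma schurE X Y (b : M) : schur Psi X Y b = mult M (tmap X Y (mult_dag Psi b)).
Proof. by rewrite !comp_lfunE. Qed.

Lemma schur_linear_l Y : linear (fun X => schur Psi X Y).
Proof.
move=> c X X'; have T : tmap (c *: X + X') Y = c *: tmap X Y + tmap X' Y.
  apply: tensor_ext => x y; rewrite add_lfunE scale_lfunE !tmap_tens.
  by rewrite add_lfunE scale_lfunE (tens_bilin _ _).1.
apply/lfunP=> b; rewrite add_lfunE scale_lfunE !schurE T.
by rewrite add_lfunE scale_lfunE linearP.
Qed.

Lemma schur_linear_r X : linear (schur Psi X).
Proof.
move=> c Y Y'; have T : tmap X (c *: Y + Y') = c *: tmap X Y + tmap X Y'.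
  apply: tensor_ext => x y; rewrite add_lfunE scale_lfunE !tmap_tens.
  by rewrite add_lfunE scale_lfunE (tens_bilin _ _).2.
apply/lfunP=> b; rewrite add_lfunE scale_lfunE !schurE T.
by rewrite add_lfunE scale_lfunE linearP.
Qed.

Lemma schur_amull_l (a : M) X Y :
  schur Psi (amull a \o X)%VF Y = (amull a \o schur Psi X Y)%VF.
Proof.
rewrite /schur !comp_lfunA; congr (_ \o _)%VF; apply: tensor_ext => x y.
by rewrite !comp_lfunE !tmap_tens !mult_tens !lfunE /= !lfunE /= mulrA.
Qed.

Lemma schur_amull_r (a : M) X Y :
  schur Psi (X \o amull a)%VF Y = (schur Psi X Y \o amull a)%VF.
Proof.
apply/lfunP=> b; rewrite [RHS]comp_lfunE !schurE [amull a b]lfunE /= mult_dag_l.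
rewrite -[tmap X Y _]comp_lfunE; congr (mult M (fun_of_lfun _ _)).
apply: tensor_ext => x y; rewrite comp_lfunE !tmap_tens.
by rewrite comp_lfunE id_lfunE.
Qed.

Lemma schur_amulr_l (c : M) X Y :
  schur Psi X (amulr c \o Y)%VF = (amulr c \o schur Psi X Y)%VF.
Proof.
rewrite /schur !comp_lfunA; congr (_ \o _)%VF; apply: tensor_ext => x y.
by rewrite !comp_lfunE !tmap_tens !mult_tens !lfunE /= !lfunE /= mulrA.
Qed.

Lemma schur_amulr_r (c : M) X Y :
  schur Psi X (Y \o amulr c)%VF = (schur Psi X Y \o amulr c)%VF.
Proof.
apply/lfunP=> b; rewrite [RHS]comp_lfunE !schurE [amulr c b]lfunE /= mult_dag_r.
rewrite -[tmap X Y _]comp_lfunE; congr (mult M (fun_of_lfun _ _)).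
apply: tensor_ext => x y; rewrite comp_lfunE !tmap_tens.
by rewrite comp_lfunE id_lfunE.
Qed.

End CStarForm.

(* sg stands for the modular group z |-> sigma_z of Psi (sigma rho below). *)
Section Laplacians.
Variables (C : numClosedFieldType) (M : cstarAlgType C).
Variables (Psi : {scalar M}) (sg : C -> 'End(M)) (delta : C) (A : 'End(M)).

Let dm2 : C := delta ^- 2.

Definition pi_r (a : M) : 'End(M) := amull a.
Definition pi_op (a : M) : 'End(M) := amulr (sg (- ('i / 2)) a).

Definition ip_L (X Y : 'End(M)) : C :=
  lftrace (dag Psi (sg 'i \o X)%VF \o Y)%VF.

Definition ip_R (X Y : 'End(M)) : C :=
  lftrace (dag Psi (X \o sg (- 'i))%VF \o Y)%VF.

Definition edge_L : {vspace 'End(M)} :=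
  limg (linfun (fun X : 'End(M) => dm2 *: schur Psi A X)).

Definition edge_R : {vspace 'End(M)} :=
  limg (linfun (fun X : 'End(M) => dm2 *: schur Psi X A)).

Definition comm_L (a : M) : 'End(M) :=
  dm2 *: ((pi_op a \o A) - (A \o pi_op a))%VF.

Definition comm_R (a : M) : 'End(M) :=
  dm2 *: ((pi_r a \o A) - (A \o pi_r a))%VF.

Lemma edge_LP (X : 'End(M)) :
  reflect (exists Y, X = dm2 *: schur Psi A Y) (X \in edge_L).
Proof.
have lA : linear (fun X : 'End(M) => dm2 *: schur Psi A X).
  by move=> c Y Z; rewrite schur_linear_r scalerDr !scalerA mulrC.
apply: (iffP memv_imgP) => [[Y _ ->]|[Y ->]]; exists Y; rewrite ?memvf //;
  by rewrite linfun_linear.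
Qed.

Lemma edge_RP (X : 'End(M)) :
  reflect (exists Y, X = dm2 *: schur Psi Y A) (X \in edge_R).
Proof.
have lA : linear (fun X : 'End(M) => dm2 *: schur Psi X A).
  by move=> c Y Z; rewrite schur_linear_l scalerDr !scalerA mulrC.
apply: (iffP memv_imgP) => [[Y _ ->]|[Y ->]]; exists Y; rewrite ?memvf //;
  by rewrite linfun_linear.
Qed.

Lemma comm_L_edge (a : M) : quantum_graph Psi delta A -> comm_L a \in edge_L.
Proof.
move=> [[d0 PsiP _] AA _ _]; apply/edge_LP; exists (comm_L a).
have lA := schur_linear_r Psi A.
rewrite {2}/comm_L -[(_ *: (_ - _))]addr0 lA.
have -> : schur Psi A 0 = 0.
  by have := lA (-1) 0 0; rewrite scaler0 addr0 scaleN1r addNr.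
rewrite addr0 -scaleN1r addrC lA (schur_amulr_r PsiP) schur_amulr_l AA.
rewrite scaleN1r addrC -comp_lfunZl -comp_lfunZr -scalerBr !scalerA -mulrA.
by rewrite [dm2 * delta ^+ 2]mulVf ?mulr1 // sqrf_eq0 gt_eqF.
Qed.

Lemma comm_R_edge (a : M) : quantum_graph Psi delta A -> comm_R a \in edge_R.
Proof.
move=> [[d0 PsiP _] AA _ _]; apply/edge_RP; exists (comm_R a).
have lA := schur_linear_l Psi A.
rewrite {2}/comm_R -[(_ *: (_ - _))]addr0 lA.
have -> : schur Psi 0 A = 0.
  by have := lA (-1) 0 0; rewrite scaler0 addr0 scaleN1r addNr.
rewrite addr0 -scaleN1r addrC lA (schur_amull_r PsiP) schur_amull_l AA.
rewrite scaleN1r addrC -comp_lfunZl -comp_lfunZr -scalerBr !scalerA -mulrA.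
by rewrite [dm2 * delta ^+ 2]mulVf ?mulr1 // sqrf_eq0 gt_eqF.
Qed.

(* comm_L and comm_R take values in the edge spaces, where vsproj is the
   identity (comm_L_edge, comm_R_edge). *)
Definition incidence_L : 'Hom(M, subvs_of edge_L) :=
  linfun (fun a : M => vsproj edge_L (comm_L a)).

Definition incidence_R : 'Hom(M, subvs_of edge_R) :=
  linfun (fun a : M => vsproj edge_R (comm_R a)).

Definition laplacian_L : 'End(M) :=
  2^-1 *: (adjoint (ip Psi) (fun X Y => ip_L (vsval X) (vsval Y)) incidence_L
           \o incidence_L)%VF.

Definition laplacian_R : 'End(M) :=
  2^-1 *: (adjoint (ip Psi) (fun X Y => ip_R (vsval X) (vsval Y)) incidence_R
           \o incidence_R)%VF.

End Laplacians.

(* The complex numbers over R, as a bundled structure. *)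
Definition Cplx (R : realType) : numClosedFieldType := R[i].

Definition toC (R : realType) (x : R) : Cplx R := x%:C%C.

Section Modular.
Variables (R : realType) (M : cstarAlgType (Cplx R)).

Definition cexp (z : Cplx R) : Cplx R :=
  toC (expR (complex.Re z)) * (cos (complex.Im z) +i* sin (complex.Im z))%C.

(* x ^ w = exp (w ln x), for x a positive real and w complex. *)
Definition cpow (x w : Cplx R) : Cplx R := cexp (w * toC (ln (complex.Re x))).

Definition spectrum (a : M) : set (Cplx R) :=
  [set l | (a - l%:A) \isn't a GRing.unit]%classic.

(* f(a) = \sum_l f(l) p_l over the (finite) spectrum of a normal element a; the
   spectral projection p_l is the Lagrange polynomial of l evaluated at a. *)
Definition funcalc (f : Cplx R -> Cplx R) (a : M) : M :=
  \sum_(l <- fset_set (spectrum a))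
    f l *: \prod_(k <- fset_set (spectrum a) | k != l)
             ((l - k)^-1 *: (a - k%:A)).

Definition elt_pow (rho : M) (w : Cplx R) : M := funcalc (fun x => cpow x w) rho.

Definition sigma (rho : M) (z : Cplx R) : 'End(M) :=
  (amull (elt_pow rho ('i * z)) \o amulr (elt_pow rho (- ('i * z))))%VF.

End Modular.

(* Main.v *)
Require Import Defs.
From mathcomp Require Import all_boot all_order all_algebra all_field.
From mathcomp Require Import finmap complex ring.
From mathcomp Require Import all_classical all_reals all_analysis.

Set Implicit Arguments.
Unset Strict Implicit.
Unset Printing Implicit Defensive.

Import Order.TTheory GRing.Theory Num.Theory.
Local Open Scope ring_scope.

(** Write W = m^dagger(1) = sum_i e_i (x) f_i, so that schur Psi X Y b is
    sum_i X(e_i) Y(f_i b).  Everything rests on three properties of W.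

    - W inverts the form (a, b) |-> Psi(a b): the sum of Psi(a e_i) f_i is a,
      and the sum of Psi(a f_i) e_i is sigma_{-i}(a).  Hence the operator
      traces twisted by sigma_{-i} and sigma_i, which define the two scalar
      products on edge spaces, are values of Psi on Schur products:
      Tr(X sigma_{-i}) = Psi((X . id)(1)) and Tr(X sigma_i) = Psi((id . X)(1))
      (lftrace_modular, lftrace_modular_inv).
    - Left multiplication by a on the first leg of W is right multiplication
      by a on the second (schur_amull1, schur_amulr1).
    - If A and A^dagger commute with the involution, then
      Psi(A(x) y) = Psi(x A^dagger(y)); so A^dagger on one leg of W is A on the
      other leg (schur_move_dag), and the same holds under Psi o m
      (Psi_schur_move).

    Polarize the Laplacian as <u, 2 Delta v> = <K(u), K(v)> and expand both
    commutators.  In each of the four traces so obtained these rules bring one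
    copy of A (or of A^dagger) to each leg of W, and then the Schur idempotence
    A . A = delta^2 A, or its adjoint, collapses the two copies into one.  This
    gives the four terms of the formula (ip_R_comm, ip_L_comm).

    On the left side pi^op contains h = sigma_{-i/2}, which has to be moved
    past A.  A commutes with sigma_{-i} by uniqueness of the modular
    automorphism (modular_commute).  That A then commutes with every sigma_z
    is spectral theory (commute_sigma): on a Peirce component p_l M p_k of the
    spectral projections of rho, sigma_{-i} is the scalar l / k, and sigma_z is
    a scalar that depends on l / k only, so every eigenspace of sigma_{-i} is
    contained in an eigenspace of sigma_z.  For this one needs that rho is
    diagonalizable, i.e. that a polynomial vanishing on the spectrum of rho
    vanishes at rho (spectrum_vanish); the C*-identity excludes the self-adjoint
    nilpotents which would obstruct it. *)

(** * Traces, adjoints and the involution *)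

Section Trace.
Variable K : fieldType.

Lemma lftrace_sum (U : vectType K) (I : finType) (X : 'End(U))
    (phi : I -> U -> K^o) (y : I -> U) :
  (forall k, linear (phi k)) ->
  (forall x, X x = \sum_k phi k x *: y k) -> lftrace X = \sum_k phi k (y k).
Proof.
move=> phil XE; transitivity (\sum_i \sum_k phi k (vbase i) * vcoord i (y k)).
  apply: eq_bigr => i _; rewrite XE /vcoord linear_sum; apply: eq_bigr => k _.
  by rewrite linearZ.
rewrite exchange_big; apply: eq_bigr => k _ /=.
rewrite [in RHS](vcoordK (y k)) (linear_sumE _ _ (phil k)).
by apply: eq_bigr => i _; rewrite mulrC.
Qed.

Lemma lftraceC (U : vectType K) (X Y : 'End(U)) :
  lftrace (X \o Y)%VF = lftrace (Y \o X)%VF.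
Proof.
have E (P Q : 'End(U)) : lftrace (P \o Q)%VF
    = \sum_i \sum_j vcoord j (Q (vbase i)) * vcoord i (P (vbase j)).
  apply: eq_bigr => i _; rewrite comp_lfunE {1}(vcoordK (Q _)) linear_sum.
  rewrite {1}/vcoord linear_sum; apply: eq_bigr => j _.
  by rewrite !linearZ.
rewrite !E exchange_big; apply: eq_bigr => i _; apply: eq_bigr => j _.
by rewrite mulrC.
Qed.

Lemma lftrace_is_linear (U : vectType K) : linear (@lftrace K U : 'End(U) -> K^o).
Proof.
move=> c X Y; rewrite /lftrace scaler_sumr -big_split; apply: eq_bigr => i _ /=.
by rewrite add_lfunE scale_lfunE /vcoord linearP.
Qed.

Lemma comp_lfunBl (U : vectType K) (X Y Z : 'End(U)) :
  ((X - Y) \o Z = (X \o Z) - (Y \o Z))%VF.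
Proof. by rewrite comp_lfunDl comp_lfunNl. Qed.

Lemma comp_lfunBr (U : vectType K) (X Y Z : 'End(U)) :
  (Z \o (X - Y) = (Z \o X) - (Z \o Y))%VF.
Proof. by rewrite comp_lfunDr comp_lfunNr. Qed.

End Trace.

Section SesquilinearAdjoint.
Variables (C : numClosedFieldType) (U V : vectType C).
Variables (hU : U -> U -> C) (hV : V -> V -> C) (f : 'Hom(U, V)).
Hypothesis UP : nondegenerate_hermitian hU.
Hypothesis hVl : forall c x y z,
  hV (c *: x + y) z = Num.conj c * hV x z + hV y z.
Hypothesis hVr : forall z c x y, hV z (c *: x + y) = c * hV z x + hV z y.

(** At v the adjoint is the Riesz representative of u |-> hV (f u) v, which
    exists as soon as hV is sesquilinear.  So the defining property of the
    adjoint holds for the scalar products on edge spaces, whose sesquilinearity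
    is immediate from their formula as a trace. *)
Lemma sesqui_adjointP u v : hV (f u) v = hU u (adjoint hU hV f v).
Proof.
rewrite /adjoint; case: xgetP => [g _ -> //|noadj].
have hV0 z : hV 0 z = 0.
  by have := hVl (-1) 0 0 z; rewrite scaler0 addr0 rmorphN1 mulN1r addNr.
have hV_suml (I : finType) (c : I -> C) (x : I -> V) z :
    hV (\sum_i c i *: x i) z = \sum_i Num.conj (c i) * hV (x i) z.
  by elim/big_rec2: _ => [|i a b _ <-]; rewrite ?hV0 ?hVl.
pose g v := sval (herm_riesz UP (fun i => hV (f (vbase i)) v)).
have gP x y : hV (f x) y = hU x (g y).
  rewrite (vcoordK x) linear_sum (herm_suml UP).
  under eq_bigr do rewrite linearZ.
  rewrite hV_suml; apply: eq_bigr => i _; congr (_ * _).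
  by rewrite /g; case: (herm_riesz _ _) => w /= ->.
have lg : linear g.
  by move=> c x y; apply: (herm_inj UP) => z; rewrite (herm_linear UP) -!gP hVr.
by case: (noadj (linfun g)) => x y; rewrite linfun_linear // gP.
Qed.

End SesquilinearAdjoint.

Section Sesquilinear.
Variables (C : numClosedFieldType) (V : lmodType C) (h : V -> V -> C).
Hypothesis hl : forall c x y z, h (c *: x + y) z = Num.conj c * h x z + h y z.
Hypothesis hr : forall z c x y, h z (c *: x + y) = c * h z x + h z y.

Lemma sesqui_scale c x y : h (c *: x) (c *: y) = Num.conj c * c * h x y.
Proof.
have h0l z : h 0 z = 0.
  by have := hl (-1) 0 0 z; rewrite scaler0 addr0 rmorphN1 mulN1r addNr.
have h0r z : h z 0 = 0.
  by have := hr z (-1) 0 0; rewrite scaler0 addr0 mulN1r addNr.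
by rewrite -[c *: x]addr0 -[c *: y]addr0 hl hr h0l h0r !addr0 mulrA.
Qed.

End Sesquilinear.

Section StarAlgebra.
Variables (C : numClosedFieldType) (M : cstarAlgType C).
Implicit Types (a b : M) (c : C).

Lemma starD a b : star (a + b) = star a + star b.
Proof. by rewrite -[a]scale1r star_conj_linear rmorph1 !scale1r. Qed.

Lemma star0 : star (0 : M) = 0.
Proof. by apply: (addrI (star 0)); rewrite -starD !addr0. Qed.

Lemma starZ c a : star (c *: a) = Num.conj c *: star a.
Proof. by rewrite -[c *: a]addr0 star_conj_linear star0 addr0. Qed.

Lemma star1 : star (1 : M) = 1 :> M.
Proof. by rewrite -[LHS]mul1r -{1}[1]starK -starM mul1r starK. Qed.

End StarAlgebra.

(** * The Casimir element m^dagger(1) *)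

(** The relation that determines sigma_{-i}. *)
Definition modular (C : numClosedFieldType) (M : cstarAlgType C)
    (Psi : {scalar M}) (s : 'End(M)) : Prop :=
  forall a b : M, Psi (a * b) = Psi (b * s a).

(** The relation that determines sigma_i, the inverse of sigma_{-i}. *)
Definition modular_inv (C : numClosedFieldType) (M : cstarAlgType C)
    (Psi : {scalar M}) (s : 'End(M)) : Prop :=
  forall a b : M, Psi (s a * b) = Psi (b * a).

Section Casimir.
Variables (C : numClosedFieldType) (M : cstarAlgType C) (Psi : {scalar M}).
Hypothesis PsiP : faithful_positive Psi.
Implicit Types (a b x y : M) (c : C) (X Y : 'End(M)).

Let IP := ip_herm PsiP.
Let TP := tensor_ip_herm IP IP.
Local Notation W := (mult_dag Psi (1 : M)).

Lemma Psi_star a : Psi (star a) = Num.conj (Psi a).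
Proof. by have := herm_conj IP 1 a; rewrite /ip star1 mul1r mulr1. Qed.

Lemma Psi_ext a b : (forall x, Psi (x * a) = Psi (x * b)) -> a = b.
Proof. by move=> ab; apply: (herm_inj IP) => x; rewrite /ip ab. Qed.

Lemma dag_eq X Y :
  (forall a b, ip Psi (X a) b = ip Psi a (Y b)) -> dag Psi X = Y.
Proof. exact: adjoint_unique. Qed.

Lemma dagK X : dag Psi (dag Psi X) = X.
Proof. by apply: dag_eq => a b; rewrite -(dagP' PsiP). Qed.

Lemma dag_comp X Y : dag Psi (X \o Y)%VF = (dag Psi Y \o dag Psi X)%VF.
Proof. by apply: dag_eq => a b; rewrite !comp_lfunE !(dagP PsiP). Qed.

Lemma dag_linear c X Y :
  dag Psi (c *: X + Y) = Num.conj c *: dag Psi X + dag Psi Y.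
Proof.
apply: dag_eq => a b; rewrite !add_lfunE !scale_lfunE !(herm_linear IP).
rewrite -!(dagP PsiP) (herm_conj IP) (herm_linear IP) rmorphD rmorphM /=.
by rewrite -!(herm_conj IP).
Qed.

Lemma dagB X Y : dag Psi (X - Y) = dag Psi X - dag Psi Y.
Proof. by rewrite addrC -scaleN1r dag_linear rmorphN1 scaleN1r addrC. Qed.

Lemma dagZ c X : dag Psi (c *: X) = Num.conj c *: dag Psi X.
Proof.
have dag0 : dag Psi 0 = 0 by have := dagB X X; rewrite !subrr.
by rewrite -[c *: X]addr0 dag_linear dag0 addr0.
Qed.

Lemma dag_amull a : dag Psi (amull a) = amull (star a).
Proof. by apply: dag_eq => x y; rewrite !lfunE /= /ip starM mulrA. Qed.

(** This is the adjunction between m and m^dagger, tested on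
    a^* (x) b^* and 1. *)
Lemma casimir_pairing a b :
  \sum_i \sum_j tcoord W i j * Psi (a * vbase i) * Psi (b * vbase j)
  = Psi (b * a).
Proof.
have -> : Psi (b * a) = tensor_ip (ip Psi) (ip Psi) (tens (star a) (star b)) W.
  by rewrite -(mult_dagP PsiP) mult_tens /ip starM !starK mulr1.
pose L (t : tensor M M) : C^o :=
  tensor_ip (ip Psi) (ip Psi) (tens (star a) (star b)) t.
have lL : linear L by move=> c s t; rewrite /L (herm_linear TP).
rewrite -[RHS]/(L W) (congr1 L (tensK W)) (linear_sum1E _ lL).
apply: eq_bigr => i _; rewrite (linear_sumE _ _ lL); apply: eq_bigr => j _.
by rewrite /L (tensor_ip_tens IP IP) /ip !starK -mulrA.
Qed.

Lemma Psi_schur1E X Y : Psi (schur Psi X Y (1 : M))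
  = \sum_i \sum_j tcoord W i j * Psi (X (vbase i) * Y (vbase j)).
Proof.
rewrite schurE {1}(tensK W) !linear_sum; apply: eq_bigr => i _.
rewrite !linear_sum; apply: eq_bigr => j _.
by rewrite !linearZ /= tmap_tens mult_tens.
Qed.

Lemma schur_amull1 X Y a :
  schur Psi (X \o amull a)%VF Y (1 : M) = schur Psi X Y a.
Proof. by rewrite (schur_amull_r PsiP) comp_lfunE [amull a 1]lfunE /= mulr1. Qed.

Lemma schur_amulr1 X Y a :
  schur Psi X (Y \o amulr a)%VF (1 : M) = schur Psi X Y a.
Proof. by rewrite (schur_amulr_r PsiP) comp_lfunE [amulr a 1]lfunE /= mul1r. Qed.

Lemma schur_mull1 X Y a :
  schur Psi (amull a \o X)%VF Y (1 : M) = a * schur Psi X Y (1 : M).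
Proof. by rewrite schur_amull_l comp_lfunE lfunE. Qed.

Lemma schur_mulr1 X Y a :
  schur Psi X (amulr a \o Y)%VF (1 : M) = schur Psi X Y (1 : M) * a.
Proof. by rewrite schur_amulr_l comp_lfunE lfunE. Qed.

Lemma Psi_schurBl X Y (Z : 'End(M)) :
  Psi (schur Psi (X - Y) Z (1 : M))
  = Psi (schur Psi X Z (1 : M)) - Psi (schur Psi Y Z (1 : M)).
Proof.
rewrite addrC -scaleN1r schur_linear_l add_lfunE scale_lfunE linearD linearZ /=.
by rewrite mulN1r addrC.
Qed.

Lemma Psi_schurBr X Y (Z : 'End(M)) :
  Psi (schur Psi Z (X - Y) (1 : M))
  = Psi (schur Psi Z X (1 : M)) - Psi (schur Psi Z Y (1 : M)).
Proof.
rewrite addrC -scaleN1r schur_linear_r add_lfunE scale_lfunE linearD linearZ /=.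
by rewrite mulN1r addrC.
Qed.

(** By casimir_pairing, s(x) is the sum of W_ij Psi(x e_j) e_i; this writes
    X o s as a sum of rank-one operators. *)
Lemma lftrace_modular (s : 'End(M)) X : modular Psi s ->
  lftrace (X \o s)%VF = Psi (schur Psi X \1%VF (1 : M)).
Proof.
move=> sP; pose phi (k : 'I_(\dim {:M}) * 'I_(\dim {:M})) (x : M) : C^o :=
  tcoord W k.1 k.2 * Psi (x * vbase k.2).
have phil k : linear (phi k).
  by move=> c x y; rewrite /phi mulrDl -scalerAl linearP mulrDr mulrCA.
rewrite Psi_schur1E (lftrace_sum (I := _) (y := fun k => X (vbase k.1)) phil).
  by rewrite pair_bigA; apply: eq_bigr => k _; rewrite /phi id_lfunE.
move=> x; rewrite comp_lfunE.
have -> : s x = \sum_k phi k x *: vbase k.1.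
  apply: Psi_ext => a; rewrite -sP -casimir_pairing pair_bigA mulr_sumr linear_sum.
  by apply: eq_bigr => k _; rewrite -scalerAr linearZ /phi /= mulrAC.
by rewrite linear_sum; apply: eq_bigr => k _; rewrite linearZ.
Qed.

(** As for lftrace_modular, with s(x) equal to the sum of
    W_ij Psi(e_i x) e_j. *)
Lemma lftrace_modular_inv (s : 'End(M)) X : modular_inv Psi s ->
  lftrace (X \o s)%VF = Psi (schur Psi \1%VF X (1 : M)).
Proof.
move=> sP; pose phi (k : 'I_(\dim {:M}) * 'I_(\dim {:M})) (x : M) : C^o :=
  tcoord W k.1 k.2 * Psi (vbase k.1 * x).
have phil k : linear (phi k).
  by move=> c x y; rewrite /phi mulrDr -scalerAr linearP mulrDr mulrCA.
rewrite Psi_schur1E (lftrace_sum (I := _) (y := fun k => X (vbase k.2)) phil).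
  by rewrite pair_bigA; apply: eq_bigr => k _; rewrite /phi id_lfunE.
move=> x; rewrite comp_lfunE.
have -> : s x = \sum_k phi k x *: vbase k.2.
  apply: Psi_ext => a; rewrite -casimir_pairing pair_bigA mulr_sumr linear_sum.
  by apply: eq_bigr => k _; rewrite -scalerAr linearZ /phi /= sP.
by rewrite linear_sum; apply: eq_bigr => k _; rewrite linearZ.
Qed.

Lemma modular_dag (s : 'End(M)) : modular Psi s -> dag Psi s = s.
Proof.
move=> sP; apply: dag_eq => a b; rewrite /ip -[RHS]sP.
by apply: (can_inj (@conjCK _)); rewrite -!Psi_star !starM !starK [RHS]sP.
Qed.

Lemma modular_inv_dag (s : 'End(M)) : modular_inv Psi s -> dag Psi s = s.
Proof.
move=> sP; apply: dag_eq => a b; rewrite /ip -[LHS]sP.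
by apply: (can_inj (@conjCK _)); rewrite -!Psi_star !starM !starK sP.
Qed.

Lemma schur_dag X Y :
  dag Psi (schur Psi X Y) = schur Psi (dag Psi X) (dag Psi Y).
Proof.
apply: dag_eq => a b.
rewrite !schurE (mult_dagP PsiP) (herm_conj IP) (mult_dagP PsiP).
rewrite -(herm_conj TP); apply/esym/(tmap_adj IP IP) => x y.
all: exact/esym/(dagP PsiP).
Qed.

(** For an operator that commutes with the involution, the adjoint for the
    sesquilinear form Psi(a^* b) is also the transpose for the bilinear form
    Psi(a b). *)
Lemma real_adj X : (forall x, star (X x) = X (star x)) ->
  forall a b, Psi (X a * b) = Psi (a * dag Psi X b).
Proof.
by move=> Xr a b; have := dagP PsiP X (star a) b; rewrite /ip Xr !starK.
Qed.

Lemma Psi_schur_move (P Q X Y : 'End(M)) :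
  (forall a b, Psi (P a * b) = Psi (a * Q b)) ->
  Psi (schur Psi (P \o X)%VF Y (1 : M)) = Psi (schur Psi X (Q \o Y)%VF (1 : M)).
Proof.
move=> PQ; rewrite !Psi_schur1E; apply: eq_bigr => i _; apply: eq_bigr => j _.
by rewrite !comp_lfunE PQ.
Qed.

(** Transposing real_adj through m^dagger: the operators A^dagger (x) id and
    id (x) A agree on W. *)
Lemma schur_move_dag (A X Y : 'End(M)) :
  (forall x, star (A x) = A (star x)) ->
  schur Psi (X \o dag Psi A)%VF Y (1 : M) = schur Psi X (Y \o A)%VF (1 : M).
Proof.
move=> A_real.
have T : tmap (dag Psi A) \1%VF W = tmap \1%VF A W.
  apply: (herm_inj TP) => t.
  rewrite (tmap_adj (X' := A) (Y' := \1%VF) IP IP); first last.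
  - by move=> x y; rewrite !id_lfunE.
  - by move=> x y; rewrite (dagP PsiP).
  rewrite (tmap_adj (X' := \1%VF) (Y' := dag Psi A) IP IP); first last.
  - exact: (dagP' PsiP).
  - by move=> x y; rewrite !id_lfunE.
  rewrite -!(mult_dagP PsiP) (herm_conj IP) [RHS](herm_conj IP); congr Num.conj.
  rewrite /ip star1 !mul1r.
  pose f t : C^o := Psi (mult M (tmap A \1 t)).
  pose g t : C^o := Psi (mult M (tmap \1 (dag Psi A) t)).
  apply: (@tensor_extf _ _ _ _ f g); rewrite /f /g => {f g t}.
  - by move=> c x y; rewrite !linearP.
  - by move=> c x y; rewrite !linearP.
  by move=> x y; rewrite !tmap_tens !mult_tens !id_lfunE real_adj.
have tmap_comp (P P' Q Q' : 'End(M)) t :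
    tmap (P \o P')%VF (Q \o Q')%VF t = tmap P Q (tmap P' Q' t).
  rewrite -comp_lfunE; congr (fun_of_lfun _ t); apply: tensor_ext => x y.
  by rewrite comp_lfunE !tmap_tens !comp_lfunE.
rewrite !schurE -[Y in LHS]comp_lfun1r -[X in RHS]comp_lfun1r.
by rewrite !tmap_comp T.
Qed.

End Casimir.

(** * The Laplacians of a quantum graph *)

Section Graph.
Variables (C : numClosedFieldType) (M : cstarAlgType C) (Psi : {scalar M}).
Variables (delta : C) (A : 'End(M)).
Hypothesis G : quantum_graph Psi delta A.

Let PsiP : faithful_positive Psi := qs_faithful (qg_system G).
Let IP := ip_herm PsiP.
Let delta_gt0 : 0 < delta := qs_delta_gt0 (qg_system G).
Local Notation A' := (dag Psi A).
Implicit Types (a b x y u v : M) (X Y Z : 'End(M)).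

Lemma quantum_graph_dag : quantum_graph Psi delta A'.
Proof.
split=> [||x|x]; first exact: qg_system G.
- rewrite -(schur_dag PsiP) (qg_schur G) (dagZ PsiP); congr (_ *: _).
  by apply/CrealP/ger0_real; rewrite exprn_ge0 // ltW.
- exact: qg_dag_real G x.
- by rewrite (dagK PsiP); apply: qg_real G x.
Qed.

Lemma Psi_adj a b : Psi (A a * b) = Psi (a * A' b).
Proof. exact/(real_adj PsiP)/(qg_real G). Qed.

Lemma Psi_adj' a b : Psi (A' a * b) = Psi (a * A b).
Proof. by rewrite (real_adj PsiP (qg_dag_real G)) (dagK PsiP). Qed.

(** A and A^dagger are transposes of each other for the bilinear form
    Psi(a b), whichever of the two is put on the left, and s compares the two
    orders of the arguments of this form. *)
Lemma modular_commute (s : 'End(M)) : modular Psi s ->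
  forall x, A (s x) = s (A x).
Proof.
move=> sP x; apply: (Psi_ext PsiP) => y.
by rewrite -Psi_adj' -[RHS]sP Psi_adj [RHS]sP.
Qed.

Lemma schur_move X Y :
  schur Psi (X \o A)%VF Y (1 : M) = schur Psi X (Y \o A')%VF (1 : M).
Proof. by rewrite -{1}[A](dagK PsiP) (schur_move_dag PsiP _ _ (qg_dag_real G)). Qed.

Lemma schur_AA x : schur Psi A A x = delta ^+ 2 *: A x.
Proof. by rewrite (qg_schur G) scale_lfunE. Qed.

Lemma schur_A'A' x : schur Psi A' A' x = delta ^+ 2 *: A' x.
Proof. by rewrite (qg_schur quantum_graph_dag) scale_lfunE. Qed.

Lemma comm_linear (pi : M -> 'End(M)) : linear pi ->
  linear (fun a => delta ^- 2 *: ((pi a \o A) - (A \o pi a))%VF).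
Proof.
move=> pil c a b; rewrite pil comp_lfunDl comp_lfunDr -comp_lfunZl -comp_lfunZr.
by rewrite opprD addrACA -scalerBr scalerDr !scalerA mulrC.
Qed.

(** Polarization: the operator (1/2) I^dagger I, with I : M -> S induced by K,
    is determined by the values of the scalar product on pairs K u, K v. *)
Lemma form_laplacian (S : {vspace 'End(M)}) (hV : 'End(M) -> 'End(M) -> C)
    (K : M -> 'End(M)) (F : M -> M) :
  (forall c X Y Z, hV (c *: X + Y) Z = Num.conj c * hV X Z + hV Y Z) ->
  (forall Z c X Y, hV Z (c *: X + Y) = c * hV Z X + hV Z Y) ->
  linear K -> (forall a, K a \in S) ->
  (forall u v, hV (K u) (K v) = ip Psi u (F v)) ->
  let I := linfun (fun a => vsproj S (K a)) in
  forall v, 2 *: (2^-1 *: (adjoint (ip Psi)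
    (fun X Y : subvs_of S => hV (vsval X) (vsval Y)) I \o I)%VF) v = F v.
Proof.
move=> hl hr Kl KS KF I v.
have IE a : vsval (I a) = K a.
  by rewrite /I linfun_linear ?vsprojK // => c x y; rewrite Kl linearP.
rewrite scale_lfunE comp_lfunE scalerA mulfV ?pnatr_eq0 // scale1r.
apply: (herm_inj IP) => u; rewrite -sesqui_adjointP ?IE //.
- by move=> c X Y Z; rewrite linearP hl.
- by move=> X c Y Z; rewrite linearP hr.
Qed.

Lemma ip_delta u v (t : C) : t = delta ^+ 2 * ip Psi u v ->
  Num.conj (delta ^- 2) * delta ^- 2 * t = ip Psi u (delta ^- 2 *: v).
Proof.
have dR : Num.conj (delta ^- 2) = delta ^- 2.
  by apply/CrealP/ger0_real; rewrite invr_ge0 exprn_ge0 // ltW.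
move=> ->; rewrite dR -mulrA mulKf ?expf_neq0 ?gt_eqF //.
by rewrite /ip -scalerAr linearZ.
Qed.

Section Sides.
Variable sg : C -> 'End(M).

Lemma ip_R_schur X Y : modular Psi (sg (- 'i)) ->
  ip_R Psi sg X Y = Psi (schur Psi (dag Psi X \o Y)%VF \1%VF (1 : M)).
Proof.
move=> sP; rewrite /ip_R (dag_comp PsiP) (modular_dag PsiP sP) -comp_lfunA lftraceC.
exact: lftrace_modular.
Qed.

Lemma ip_L_schur X Y : modular_inv Psi (sg 'i) ->
  ip_L Psi sg X Y = Psi (schur Psi \1%VF (Y \o dag Psi X)%VF (1 : M)).
Proof.
move=> sP; rewrite /ip_L (dag_comp PsiP) (modular_inv_dag PsiP sP) -comp_lfunA.
by rewrite lftraceC -comp_lfunA lftraceC; apply: lftrace_modular_inv.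
Qed.

Lemma trace_form_linear_r (P : 'End(M)) c X Y :
  lftrace (P \o (c *: X + Y))%VF = c * lftrace (P \o X)%VF + lftrace (P \o Y)%VF.
Proof. by rewrite comp_lfunDr -comp_lfunZr lftrace_is_linear. Qed.

Lemma ip_R_linear_r X c Y Z :
  ip_R Psi sg X (c *: Y + Z) = c * ip_R Psi sg X Y + ip_R Psi sg X Z.
Proof. exact: trace_form_linear_r. Qed.

Lemma ip_L_linear_r X c Y Z :
  ip_L Psi sg X (c *: Y + Z) = c * ip_L Psi sg X Y + ip_L Psi sg X Z.
Proof. exact: trace_form_linear_r. Qed.

Lemma ip_R_linear_l c X Y Z :
  ip_R Psi sg (c *: X + Y) Z = Num.conj c * ip_R Psi sg X Z + ip_R Psi sg Y Z.
Proof.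
rewrite /ip_R comp_lfunDl -comp_lfunZl (dag_linear PsiP) comp_lfunDl -comp_lfunZl.
exact: lftrace_is_linear.
Qed.

Lemma ip_L_linear_l c X Y Z :
  ip_L Psi sg (c *: X + Y) Z = Num.conj c * ip_L Psi sg X Z + ip_L Psi sg Y Z.
Proof.
rewrite /ip_L comp_lfunDr -comp_lfunZr (dag_linear PsiP) comp_lfunDl -comp_lfunZl.
exact: lftrace_is_linear.
Qed.

(** E1-E4 are the four traces of the expanded product of commutators.  In each
    of them one of the two factors A, A^dagger is moved to the second leg of
    the Casimir element. *)
Lemma ip_R_comm u v : modular Psi (sg (- 'i)) ->
  ip_R Psi sg ((amull u \o A) - (A \o amull u))%VF
              ((amull v \o A) - (A \o amull v))%VF
  = delta ^+ 2 * ip Psi u (A' (1 : M) * v + v * A (1 : M) - A v - A' v).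
Proof.
move=> sP; rewrite (ip_R_schur _ _ sP) (dagB PsiP) !(dag_comp PsiP).
rewrite !(dag_amull PsiP); set p := star u.
have mA' := Psi_schur_move _ _ Psi_adj'.
have E1 : Psi (schur Psi (A' \o (amull p \o (amull v \o A)))%VF \1%VF (1 : M))
    = delta ^+ 2 * Psi (p * (v * A (1 : M))).
  by rewrite mA' comp_lfun1r schur_mull1 schur_mull1 schur_AA -!scalerAr linearZ.
have E2 : Psi (schur Psi (A' \o (amull p \o (A \o amull v)))%VF \1%VF (1 : M))
    = delta ^+ 2 * Psi (p * A v).
  rewrite mA' comp_lfun1r schur_mull1 (schur_amull1 PsiP) schur_AA.
  by rewrite -!scalerAr linearZ.
have E3 : Psi (schur Psi (amull p \o (A' \o (amull v \o A)))%VF \1%VF (1 : M))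
    = delta ^+ 2 * Psi (p * A' v).
  rewrite schur_mull1 !comp_lfunA schur_move comp_lfun1l (schur_amull1 PsiP).
  by rewrite schur_A'A' -!scalerAr linearZ.
have E4 : Psi (schur Psi (amull p \o (A' \o (A \o amull v)))%VF \1%VF (1 : M))
    = delta ^+ 2 * Psi (p * (A' (1 : M) * v)).
  rewrite schur_mull1 comp_lfunA (schur_amull1 PsiP) -(schur_amulr1 PsiP).
  by rewrite comp_lfun1l schur_move schur_mulr1 schur_A'A' -scalerAl -scalerAr linearZ.
rewrite comp_lfunBl [X in X - _]comp_lfunBr [X in _ - X]comp_lfunBr -!comp_lfunA.
rewrite 2!Psi_schurBl E1 E2 Psi_schurBl E3 E4 /ip -/p 2!mulrBr mulrDr 2!linearB linearD /=.
by ring.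
Qed.

Lemma laplacian_RE v : modular Psi (sg (- 'i)) ->
  2 *: laplacian_R Psi sg delta A v
  = delta ^- 2 *: (A' (1 : M) * v + v * A (1 : M) - A v - A' v).
Proof.
move=> sP.
pose F v := delta ^- 2 *: (A' (1 : M) * v + v * A (1 : M) - A v - A' v).
apply: (form_laplacian (F := F) ip_R_linear_l ip_R_linear_r).
- by apply: comm_linear => c a b; rewrite /pi_r linearP.
- by move=> a; apply: comm_R_edge.
move=> u {}v; rewrite /comm_R (sesqui_scale ip_R_linear_l ip_R_linear_r).
exact/ip_delta/ip_R_comm.
Qed.

Section Left.
Local Notation h := (sg (- ('i / 2))).
Hypothesis sgi : modular_inv Psi (sg 'i).
Hypothesis hA : forall x, A (h x) = h (A x).
Hypothesis hA' : forall x, A' (h x) = h (A' x).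
Hypothesis hM : forall x y, h (x * y) = h x * h y.
Hypothesis h1 : h (1 : M) = 1.
Hypothesis hPsi : forall x, Psi (h x) = Psi x.
Hypothesis h_star : forall x, dag Psi (amulr (h x)) = amulr (h (star x)).

(** The mirror image of ip_R_comm.  Here every term is first obtained with
    the images under h of u^* and v in place of u^* and v; as h is
    multiplicative and commutes with A and A^dagger, it comes to act on the
    whole argument of Psi, where it disappears. *)
Lemma ip_L_comm u v :
  ip_L Psi sg ((amulr (h u) \o A) - (A \o amulr (h u)))%VF
              ((amulr (h v) \o A) - (A \o amulr (h v)))%VF
  = delta ^+ 2 * ip Psi u (v * A' (1 : M) + A (1 : M) * v - A v - A' v).
Proof.
rewrite (ip_L_schur _ _ sgi) (dagB PsiP) !(dag_comp PsiP) !h_star.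
set p := h (star u); set q := h v.
have mA X : Psi (schur Psi \1%VF (A \o X)%VF (1 : M)) = Psi (schur Psi A' X (1 : M)).
  by rewrite -(Psi_schur_move _ _ Psi_adj') comp_lfun1r.
have E1 : Psi (schur Psi \1%VF (amulr q \o (A \o (A' \o amulr p)))%VF (1 : M))
    = delta ^+ 2 * Psi (star u * (A (1 : M) * v)).
  rewrite schur_mulr1 comp_lfunA (schur_amulr1 PsiP) -(schur_amull1 PsiP) comp_lfun1l.
  rewrite -schur_move schur_mull1 schur_AA -scalerAr -scalerAl linearZ /=.
  by rewrite -(hPsi (star u * _)) !hM -hA h1 mulrA.
have E2 : Psi (schur Psi \1%VF (amulr q \o (A \o (amulr p \o A')))%VF (1 : M))
    = delta ^+ 2 * Psi (star u * A' v).
  rewrite schur_mulr1 comp_lfunA -schur_move comp_lfun1l (schur_amulr1 PsiP) schur_AA.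
  by rewrite -scalerAl linearZ /= hA -hM hPsi Psi_adj.
have E3 : Psi (schur Psi \1%VF (A \o (amulr q \o (A' \o amulr p)))%VF (1 : M))
    = delta ^+ 2 * Psi (star u * A v).
  rewrite mA schur_mulr1 (schur_amulr1 PsiP) schur_A'A'.
  by rewrite -scalerAl linearZ /= hA' -hM hPsi Psi_adj'.
have E4 : Psi (schur Psi \1%VF (A \o (amulr q \o (amulr p \o A')))%VF (1 : M))
    = delta ^+ 2 * Psi (star u * (v * A' (1 : M))).
  rewrite mA schur_mulr1 schur_mulr1 schur_A'A' -!scalerAl linearZ /=.
  congr (_ * _); rewrite -{1}h1 hA' -!hM hPsi.
  (* A^dagger(1) goes from the left end to the right end: Psi(A^dagger(1) x)
     and Psi(x A^dagger(1)) are both Psi(A x). *)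
  by rewrite -mulrA Psi_adj' mul1r mulrA -Psi_adj mulr1.
rewrite comp_lfunBl [X in X - _]comp_lfunBr [X in _ - X]comp_lfunBr -!comp_lfunA.
rewrite 2!Psi_schurBr E1 E2 Psi_schurBr E3 E4 /ip 2!mulrBr mulrDr 2!linearB linearD /=.
by ring.
Qed.

Lemma laplacian_LE v :
  2 *: laplacian_L Psi sg delta A v
  = delta ^- 2 *: (op_mul (A' (1 : M)) v + op_mul v (A (1 : M)) - A v - A' v).
Proof.
pose F v :=
  delta ^- 2 *: (op_mul (A' (1 : M)) v + op_mul v (A (1 : M)) - A v - A' v).
apply: (form_laplacian (F := F) ip_L_linear_l ip_L_linear_r).
- by apply: comm_linear => c a b; rewrite /pi_op !linearP.
- by move=> a; apply: comm_L_edge.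
move=> u {}v; rewrite /comm_L (sesqui_scale ip_L_linear_l ip_L_linear_r).
exact/ip_delta/ip_L_comm.
Qed.

End Left.
End Sides.
End Graph.

(** * Spectral theory of self-adjoint elements *)

Section Falgebra.
Variables (K : fieldType) (M : falgType K).
Implicit Types (a x y v : M) (p q : {poly K}).

Lemma horner_algZ a c p : horner_alg a (c *: p) = c *: horner_alg a p.
Proof. by rewrite linearZ /= mulr_algl. Qed.

(** The powers 1, a, ..., a^n cannot be free when n is the dimension. *)
Lemma horner_alg_annihilator a :
  exists2 p : {poly K}, p != 0 & horner_alg a p = 0.
Proof.
set n := \dim {:M}; pose X := [tuple a ^+ i | i < n.+1].
have nfX : ~ free X.
  rewrite /free size_tuple => /eqP dX.
  by have := dimvS (subvf <<X>>%VS); rewrite dX ltnn.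
have /existsNP [k /not_implyP [kX /existsNP [i /eqP ki]]] :=
  contra_not (introT vector.freeP) nfX.
exists (\poly_(j < n.+1) k (inord j)).
  apply/eqP => /(congr1 (fun q : {poly K} => q`_i)).
  by rewrite coef_poly ltn_ord inord_val coef0; apply/eqP.
have XE (j : 'I_n.+1) : X`_j = a ^+ j by rewrite -tnth_nth tnth_mktuple.
rewrite poly_def rmorph_sum -[RHS]kX; apply: eq_bigr => j _ /=.
by rewrite horner_algZ rmorphXn /= horner_algX inord_val XE.
Qed.

(** In finite dimension, left multiplication by a is bijective as soon as it
    is injective, and its inverse is then multiplication by an inverse of a. *)
Lemma nonunit_ann a : a \isn't a GRing.unit -> exists2 v, v != 0 & a * v = 0.
Proof.
move=> aNu; case: (boolP (lker (amull a) == 0%VS)) => [/eqP k0|kN0]; last first.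
  exists (vpick (lker (amull a))); first by rewrite vpick0.
  by apply/eqP; have := memv_pick (lker (amull a)); rewrite memv_ker lfunE.
have iF : limg (amull a) = fullv.
  by apply/eqP; rewrite eqEdim subvf limg_dim_eq ?k0 ?capv0 //=.
pose b := ((amull a)^-1)%VF 1.
have ab : a * b = 1.
  have : amull a b = 1 by apply: limg_lfunVK; rewrite iF memvf.
  by rewrite lfunE.
have ba : b * a = 1.
  apply/eqP; rewrite -subr_eq0 -memv0 -k0 memv_ker lfunE /=.
  by rewrite mulrBr mulrA ab mul1r mulr1 subrr.
by case/negP: aNu; apply/unitrP; exists b.
Qed.

Lemma nonunit_eigen a l : (a - l%:A) \isn't a GRing.unit ->
  exists2 v, v != 0 & a * v = l *: v.
Proof.
move=> /nonunit_ann [v v0 av]; exists v => //.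
by apply/eqP; rewrite -subr_eq0 -av mulrBl mulr_algl.
Qed.

Lemma horner_alg_eigen a v l p : a * v = l *: v -> horner_alg a p * v = p.[l] *: v.
Proof.
move=> av; elim/poly_ind: p => [|p c IH].
  by rewrite rmorph0 mul0r horner0 scale0r.
rewrite rmorphD rmorphM /= horner_algX horner_algC hornerMXaddC mulrDl -mulrA av.
by rewrite -scalerAr IH mulr_algl scalerDl scalerA mulrC.
Qed.

Lemma nonunit_root a p l : (a - l%:A) \isn't a GRing.unit ->
  horner_alg a p = 0 -> root p l.
Proof.
move=> /nonunit_eigen [v v0 av] pa.
have := horner_alg_eigen p av; rewrite pa mul0r => /esym/eqP.
by rewrite scaler_eq0 (negPf v0) orbF.
Qed.

End Falgebra.

Section CStarSpectrum.
Variables (C : numClosedFieldType) (M : cstarAlgType C).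
Implicit Types (a : M) (p q : {poly C}).

Lemma cstar_sqr_eq0 a : star a = a -> a ^+ 2 = 0 -> a = 0.
Proof.
move=> sa a0; apply: cnorm_eq0.
have cn0 : cnorm (0 : M) = 0 by rewrite -(scale0r (0 : M)) cnormZ normr0 mul0r.
have := cnorm_star a; rewrite sa -expr2 a0 cn0 => /esym/eqP.
by rewrite expf_eq0 => /eqP.
Qed.

(** Some power of exponent 2^k vanishes, and the exponent can be halved. *)
Lemma selfadjoint_nilpotent a n : star a = a -> a ^+ n = 0 -> a = 0.
Proof.
move=> sa an; have sX k : star (a ^+ k) = a ^+ k.
  by elim: k => [|k IH]; rewrite ?expr0 ?star1 // exprSr starM sa IH -exprS -exprSr.
have : a ^+ (2 ^ n) = 0.
  by rewrite -(subnK (ltnW (ltn_expl n (isT : 1 < 2)%N))) exprD an mulr0.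
by elim: {an} n => [|n IH]; rewrite ?expr1 // expnSr exprM => /(cstar_sqr_eq0 (sX _)).
Qed.

Lemma star_horner_alg a p : star a = a ->
  star (horner_alg a p) = horner_alg a (map_poly Num.conj p).
Proof.
move=> sa; elim/poly_ind: p => [|p c IH]; first by rewrite !rmorph0 star0.
rewrite !rmorphD !rmorphM /= map_polyX map_polyC /= !horner_algX !horner_algC.
rewrite starD starM IH sa starZ star1; congr (_ + _).
have := congr1 (horner_alg a) (mulrC 'X (map_poly Num.conj p)).
by rewrite !rmorphM /= horner_algX.
Qed.

(** Let Q be the product of the X - l for l in the spectrum.  Deleting from an
    annihilator of a the factors X - z with a - z invertible leaves a divisor
    of a power of Q; so Q(a) is nilpotent, and self-adjoint because the
    spectrum is real. *)
Lemma spectrum_vanish a (S : seq C) p :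
  star a = a -> (forall l, (l \in S) = ((a - l%:A) \isn't a GRing.unit)) ->
  {in S, forall l, l \is Num.real} -> uniq S ->
  {in S, forall l, root p l} -> horner_alg a p = 0.
Proof.
move=> sa SP SR Su pS; pose Q : {poly C} := \prod_(l <- S) ('X - l%:P).
suff Q0 : horner_alg a Q = 0.
  have /dvdpP [q ->] : Q %| p.
    by apply: uniq_roots_dvdp; rewrite ?uniq_rootsE //; apply/allP.
  by rewrite rmorphM /= Q0 mulr0.
have QR : star (horner_alg a Q) = horner_alg a Q.
  rewrite star_horner_alg // rmorph_prod; congr (horner_alg a _).
  apply: eq_big_seq => l lS; rewrite /= map_polyXsubC.
  by congr ('X - _%:P); apply/CrealP/SR.
have [p0 p0N0 ap0] := horner_alg_annihilator a.
have [rs p0E] := closed_field_poly_normal p0.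
apply: (@selfadjoint_nilpotent _ (size rs)) => //.
have c0 : lead_coef p0 != 0 by rewrite lead_coef_eq0.
pose P b : {poly C} := \prod_(z <- rs | (z \in S) == b) ('X - z%:P).
have PE : horner_alg a (P true) * horner_alg a (P false) = 0.
  apply: (scalerI c0); rewrite scaler0 -ap0 [in RHS]p0E horner_algZ -rmorphM /=.
  congr (_ *: horner_alg a _); rewrite (bigID (mem S)) /P /=; congr (_ * _).
    by apply: eq_bigl => z; rewrite eqb_id.
  by apply: eq_bigl => z; rewrite eqbF_neg.
have PU : horner_alg a (P false) \is a GRing.unit.
  rewrite rmorph_prod.
  apply: (big_ind (fun x => x \is a GRing.unit)) => [|x y xu yu|z].
  - exact: unitr1.
  - by rewrite unitrMl.
  - by rewrite SP rmorphB /= horner_algX horner_algC eqbF_neg negbK.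
have P0 : horner_alg a (P true) = 0 by rewrite -[LHS](mulrK PU) PE mul0r.
have /dvdpP [q QE] : P true %| Q ^+ size rs.
  rewrite /P; elim: (rs) => [|z r IH]; first by rewrite big_nil dvd1p.
  rewrite big_cons exprS /= eqb_id; case: ifP => [zS|_]; last exact: dvdp_mull.
  by apply: dvdp_mul => //; rewrite dvdp_XsubCl root_prod_XsubC.
by rewrite -rmorphXn QE rmorphM /= P0 mulr0.
Qed.

End CStarSpectrum.

(** * Functional calculus of positive invertible elements *)

Section Lagrange.
Variables (K : fieldType) (S : seq K).
Hypothesis Su : uniq S.

Definition lagrange (l : K) : {poly K} :=
  \prod_(k <- S | k != l) ((l - k)^-1 *: ('X - k%:P)).

Definition interpol (f : K -> K) : {poly K} := \sum_(l <- S) f l *: lagrange l.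

Lemma horner_lagrange l k : k \in S -> (lagrange l).[k] = (k == l)%:R.
Proof.
move=> kS; rewrite /lagrange horner_prod; have [->|kl] := eqVneq k l.
  by rewrite big1 // => m ml; rewrite hornerZ hornerXsubC mulVf // subr_eq0 eq_sym.
apply/eqP; rewrite prodf_seq_eq0; apply/hasP; exists k => //.
by rewrite kl hornerZ hornerXsubC subrr mulr0 eqxx.
Qed.

Lemma horner_interpol f k : k \in S -> (interpol f).[k] = f k.
Proof.
move=> kS; rewrite /interpol horner_sum (bigD1_seq k) //= hornerZ horner_lagrange //.
rewrite eqxx mulr1 big1 ?addr0 // => l lk.
by rewrite hornerZ horner_lagrange // eq_sym (negPf lk) mulr0.
Qed.

End Lagrange.

Section FunCalc.
Variables (R : realType) (M : cstarAlgType (Cplx R)).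
Local Notation C := (Cplx R).

Lemma spectrum_finite (a : M) : finite_set (spectrum a).
Proof.
have [p p0 ap] := horner_alg_annihilator a.
have [rs pE] := closed_field_poly_normal p.
apply: (@sub_finite_set _ _ [set` rs]%classic); last exact: finite_seq.
move=> l /= la; have := nonunit_root la ap.
by rewrite pE rootZ ?lead_coef_eq0 // root_prod_XsubC.
Qed.

Lemma mem_spectrum (a : M) l :
  (l \in fset_set (spectrum a)) = ((a - l%:A) \isn't a GRing.unit).
Proof.
rewrite in_fset_set; last exact: spectrum_finite.
by apply/idP/idP; rewrite inE.
Qed.

Section Positive.
Variables (Phi : {scalar M}) (a : M).
Hypothesis PhiP : faithful_positive Phi.
Hypothesis aP : positive_elt a.
Hypothesis aU : a \is a GRing.unit.
Local Notation S := (fset_set (spectrum a)).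

(** If a = b^* b and a v = l v, then l Phi(v^* v) = Phi((b v)^* (b v)). *)
Lemma spectrum_gt0 l : l \in S -> 0 < l.
Proof.
move=> lS; have l0 : l != 0.
  by apply: contraTneq lS => ->; rewrite mem_spectrum scale0r subr0 negbK.
have := lS; rewrite mem_spectrum => /nonunit_eigen [v v0 av].
have vv : 0 < Phi (star v * v).
  by rewrite lt_def PhiP.1 andbT; apply: contra_neq v0 => /PhiP.2.
have [b ab] := aP.
have : 0 <= l * Phi (star v * v).
  have -> : l * Phi (star v * v) = Phi (star (b * v) * (b * v)).
    by rewrite starM -mulrA (mulrA (star b)) -ab av -scalerAr linearZ.
  exact: PhiP.1.
by rewrite pmulr_lge0 // lt_def l0.
Qed.

(** Any polynomial that interpolates f on the spectrum computes f(a), so that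
    identities between functions on the spectrum pass to the calculus. *)
Lemma funcalcE (f : C -> C) p : {in S, forall k, p.[k] = f k} ->
  funcalc f a = horner_alg a p.
Proof.
move=> pf; have -> : funcalc f a = horner_alg a (interpol S f).
  rewrite /funcalc /interpol rmorph_sum; apply: eq_bigr => l _ /=.
  rewrite horner_algZ rmorph_prod; congr (_ *: _); apply: eq_bigr => k _ /=.
  by rewrite horner_algZ rmorphB /= horner_algX horner_algC.
apply/eqP; rewrite -subr_eq0 -rmorphB; apply/eqP.
apply: (@spectrum_vanish _ _ a S) => //.
- by have [b ->] := aP; rewrite starM starK.
- exact: mem_spectrum.
- by move=> l /spectrum_gt0 /gtr0_real.
- exact: fset_uniq.
by move=> k kS; rewrite rootE hornerD hornerN pf // horner_interpol ?fset_uniq ?subrr.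
Qed.

Lemma funcalc_interpol f : funcalc f a = horner_alg a (interpol S f).
Proof. by apply: funcalcE => k kS; rewrite horner_interpol ?fset_uniq. Qed.

Lemma eq_funcalc f g : {in S, f =1 g} -> funcalc f a = funcalc g a.
Proof.
move=> fg; rewrite (funcalc_interpol g); apply: funcalcE => k kS.
by rewrite horner_interpol ?fset_uniq ?fg.
Qed.

Lemma funcalc_id : funcalc id a = a.
Proof. by rewrite (@funcalcE _ 'X) ?horner_algX // => k _; rewrite hornerX. Qed.

Lemma funcalc1 : funcalc (fun=> 1) a = 1.
Proof. by rewrite (@funcalcE _ 1) ?rmorph1 // => k _; rewrite hornerC. Qed.

Lemma funcalcZ c f : funcalc (fun x => c * f x) a = c *: funcalc f a.
Proof.
rewrite (funcalc_interpol f) -horner_algZ; apply: funcalcE => k kS.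
by rewrite hornerZ horner_interpol ?fset_uniq.
Qed.

Lemma funcalcM f g : funcalc f a * funcalc g a = funcalc (fun x => f x * g x) a.
Proof.
rewrite (funcalc_interpol f) (funcalc_interpol g) -rmorphM.
by apply/esym/funcalcE => k kS; rewrite hornerM !horner_interpol ?fset_uniq.
Qed.

Lemma star_funcalc f : star (funcalc f a) = funcalc (fun x => Num.conj (f x)) a.
Proof.
rewrite funcalc_interpol star_horner_alg; last first.
  by have [b ->] := aP; rewrite starM starK.
apply/esym/funcalcE => k kS.
have {1}<- : Num.conj k = k by apply/CrealP/gtr0_real/spectrum_gt0.
by rewrite horner_map /= horner_interpol ?fset_uniq.
Qed.

Definition eigenproj (l : C) : M := funcalc (fun k => (k == l)%:R) a.

Lemma eigenproj_sum : \sum_(l <- S) eigenproj l = 1.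
Proof.
rewrite -funcalc1 funcalc_interpol /interpol rmorph_sum; apply: eq_bigr => l _.
by rewrite scale1r; apply: funcalcE => k kS; rewrite horner_lagrange.
Qed.

Lemma funcalc_eigenproj f l : funcalc f a * eigenproj l = f l *: eigenproj l.
Proof.
rewrite /eigenproj funcalcM -funcalcZ; apply: eq_funcalc => k _ /=.
by case: eqP => [->|]; rewrite ?mulr0.
Qed.

Lemma eigenproj_funcalc f l : eigenproj l * funcalc f a = f l *: eigenproj l.
Proof.
rewrite /eigenproj funcalcM -funcalcZ; apply: eq_funcalc => k _ /=.
by rewrite mulrC; case: eqP => [->|]; rewrite ?mulr0.
Qed.

Lemma peirce_sum x :
  x = \sum_(m <- S) \sum_(n <- S) eigenproj m * x * eigenproj n.
Proof.
under eq_bigr do rewrite -mulr_sumr.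
by rewrite -!mulr_suml eigenproj_sum mul1r mulr1.
Qed.

Lemma peirce_ext x y :
  {in S &, forall m n, eigenproj m * x * eigenproj n = eigenproj m * y * eigenproj n} ->
  x = y.
Proof.
move=> xy; rewrite (peirce_sum x) (peirce_sum y).
by apply: eq_big_seq => m mS; apply: eq_big_seq => n nS; apply: xy.
Qed.

End Positive.
End FunCalc.

(** * Complex powers and the modular group *)

Section ComplexPower.
Variable R : realType.
Local Notation C := (Cplx R).
Implicit Types (z w l m : C).

Lemma cexpD z w : cexp (z + w) = cexp z * cexp w.
Proof.
case: z w => [a b] [c d]; rewrite /cexp /toC /= expRD cosD sinD.
by apply/eqP; rewrite eq_complex /=; apply/andP; split; apply/eqP; ring.
Qed.

Lemma cexp_real (x : R) : cexp (toC x) = toC (expR x).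
Proof. by rewrite /cexp /toC /= cos0 sin0; apply: mulr1. Qed.

Lemma conj_cexp z : Num.conj (cexp z) = cexp (Num.conj z).
Proof.
case: z => a b.
have cE (x : C) : Num.conj x = conjc x by reflexivity.
rewrite !cE /cexp /toC /= cosN sinN.
by apply/eqP; rewrite eq_complex /=; apply/andP; split; apply/eqP; ring.
Qed.

Lemma toC_Re l : 0 < l -> l = toC (complex.Re l).
Proof. by case: l => a b; rewrite ltcE /= => /andP[/eqP -> _]. Qed.

Lemma Re_gt0 l : 0 < l -> 0 < complex.Re l.
Proof. by case: l => a b; rewrite ltcE /= => /andP[_]. Qed.

Lemma cpowD l z w : cpow l (z + w) = cpow l z * cpow l w.
Proof. by rewrite /cpow mulrDl cexpD. Qed.

Lemma cpow0 l : cpow l 0 = 1.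
Proof. by rewrite /cpow mul0r (cexp_real 0) expR0. Qed.

Lemma cpow1 l : 0 < l -> cpow l 1 = l.
Proof.
by move=> l0; rewrite /cpow mul1r cexp_real lnK -?toC_Re // posrE Re_gt0.
Qed.

Lemma conj_cpow l w : Num.conj (cpow l w) = cpow l (Num.conj w).
Proof.
rewrite /cpow conj_cexp rmorphM /=; congr (cexp (_ * _)).
exact: conjc_real.
Qed.

Lemma cpow_div l m w : 0 < l -> 0 < m ->
  cpow l w * cpow m (- w) = cpow (l / m) w.
Proof.
move=> l0 m0; rewrite /cpow -cexpD mulNr -mulrBr; congr (cexp (_ * _)).
have -> : complex.Re (l / m) = complex.Re l / complex.Re m.
  rewrite {1}(toC_Re l0) {1}(toC_Re m0).
  by rewrite -[toC _ / _](fmorph_div (real_complex R)).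
rewrite ln_div ?posrE ?Re_gt0 //; exact/esym/(rmorphB (real_complex R)).
Qed.

End ComplexPower.

Section ModularGroup.
Variables (R : realType) (M : cstarAlgType (Cplx R)).
Variables (Psi tau : {scalar M}) (rho : M).
Local Notation C := (Cplx R).
Hypothesis PsiP : faithful_positive Psi.
Hypothesis rhoP : density Psi tau rho.
Local Notation S := (fset_set (spectrum rho)).
Local Notation E := (elt_pow rho).
Local Notation e := (eigenproj rho).
Implicit Types (x y : M) (z w : C).

Let tauC x y : tau (x * y) = tau (y * x).
Proof. by case: rhoP => [[_ +] _ _ _]; apply. Qed.

Let rho_pos : positive_elt rho. Proof. by case: rhoP. Qed.
Let rho_unit : rho \is a GRing.unit. Proof. by case: rhoP. Qed.
Let PsiE x : Psi x = tau (rho * x). Proof. by case: rhoP. Qed.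
Let S_gt0 l : l \in S -> 0 < l. Proof. exact: spectrum_gt0 PsiP rho_pos rho_unit l. Qed.

Lemma elt_powD z w : E (z + w) = E z * E w.
Proof.
rewrite /elt_pow (funcalcM PsiP) //; apply: (eq_funcalc PsiP) => // l _.
exact: cpowD.
Qed.

Lemma elt_pow0 : E 0 = 1.
Proof.
rewrite -(funcalc1 PsiP rho_pos rho_unit); apply: (eq_funcalc PsiP) => // l _.
exact: cpow0.
Qed.

Lemma elt_pow1 : E 1 = rho.
Proof.
rewrite -[RHS](funcalc_id PsiP rho_pos rho_unit).
by apply: (eq_funcalc PsiP) => // l lS; apply/cpow1/S_gt0.
Qed.

Lemma star_elt_pow w : star (E w) = E (Num.conj w).
Proof.
rewrite /elt_pow (star_funcalc PsiP) //; apply: (eq_funcalc PsiP) => // l _.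
exact: conj_cpow.
Qed.

Lemma elt_powN w : E w * E (- w) = 1.
Proof. by rewrite -elt_powD subrr elt_pow0. Qed.

Lemma elt_powVN w : E (- w) * E w = 1.
Proof. by rewrite -elt_powD addNr elt_pow0. Qed.

Lemma elt_powC w : E w * rho = rho * E w.
Proof. by move: (elt_powD w 1); rewrite addrC elt_powD !elt_pow1. Qed.

Lemma sigmaE z x : sigma rho z x = E ('i * z) * x * E (- ('i * z)).
Proof. by rewrite comp_lfunE !lfunE /= mulrA. Qed.

Lemma sigmaD z w x : sigma rho (z + w) x = sigma rho z (sigma rho w x).
Proof.
rewrite !sigmaE mulrDr opprD elt_powD [- _ - _]addrC elt_powD.
by rewrite !mulrA.
Qed.

Lemma sigmaM z x y : sigma rho z (x * y) = sigma rho z x * sigma rho z y.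
Proof.
rewrite !sigmaE !mulrA -[in RHS](mulrA _ (E _) (E _)).
by rewrite elt_powVN mulr1.
Qed.

Lemma sigma1 z : sigma rho z 1 = 1.
Proof. by rewrite sigmaE mulr1 elt_powN. Qed.

Lemma star_sigma z x : star (sigma rho z x) = sigma rho (Num.conj z) (star x).
Proof.
rewrite !sigmaE !starM !star_elt_pow mulrA rmorphN !rmorphM /= conjCi.
by rewrite !mulNr opprK -!mulrA.
Qed.

Lemma Psi_sigma z x : Psi (sigma rho z x) = Psi x.
Proof. by rewrite sigmaE !PsiE !mulrA -elt_powC tauC !mulrA elt_powVN mul1r. Qed.

Lemma sigma_modular : modular Psi (sigma rho (- 'i)).
Proof.
have rhoV : E (-1) * rho = 1 by rewrite -[in X in _ * X]elt_pow1 elt_powVN.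
move=> x y; rewrite sigmaE mulrN -expr2 sqrCi opprK elt_pow1 !PsiE.
by rewrite !mulrA [RHS]tauC !mulrA rhoV mul1r -[in RHS]mulrA [RHS]tauC.
Qed.

Lemma sigma_modular_inv : modular_inv Psi (sigma rho 'i).
Proof.
have rhoV : rho * E (-1) = 1 by rewrite -[X in X * _]elt_pow1 elt_powN.
move=> x y; rewrite sigmaE -expr2 sqrCi opprK elt_pow1 !PsiE.
by rewrite !mulrA rhoV mul1r -[in LHS]mulrA tauC.
Qed.

(** sigma_{-i/2} after the involution equals the involution after
    sigma_{i/2}; the factor sigma_{-i} picked up by modularity restores
    sigma_{-i/2}.  So the representation pi^op preserves the involution. *)
Lemma dag_amulr_sigma x :
  dag Psi (amulr (sigma rho (- ('i / 2)) x))
  = amulr (sigma rho (- ('i / 2)) (star x)).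
Proof.
apply: (dag_eq PsiP) => a b; rewrite [amulr _ a]lfunE [amulr _ b]lfunE /= /ip.
rewrite starM star_sigma -mulrA sigma_modular -sigmaD mulrA.
congr (Psi (_ * sigma rho _ _)).
rewrite rmorphN rmorphM /= conjCi fmorphV rmorph_nat mulNr opprK.
by field.
Qed.

Lemma eigenproj_sigma z m n x : m \in S -> n \in S ->
  e m * sigma rho z x * e n = cpow (m / n) ('i * z) *: (e m * x * e n).
Proof.
move=> mS nS; rewrite sigmaE !mulrA (eigenproj_funcalc PsiP) // -!mulrA.
rewrite (funcalc_eigenproj PsiP) // -cpow_div ?S_gt0 //.
by rewrite -!scalerAl -!scalerAr scalerA !mulrA.
Qed.

Lemma sigma_peirce z m n x : m \in S -> n \in S ->
  sigma rho z (e m * x * e n) = cpow (m / n) ('i * z) *: (e m * x * e n).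
Proof.
move=> mS nS; rewrite sigmaE !mulrA (funcalc_eigenproj PsiP) // -!mulrA.
rewrite (eigenproj_funcalc PsiP) // -cpow_div ?S_gt0 //.
by rewrite -!scalerAl -!scalerAr scalerA !mulrA.
Qed.

(** A maps the Peirce component (k, l) into the eigenspace of sigma_{-i} for
    k / l, whose components (m, n) all have m / n = k / l; sigma_z is one and
    the same scalar on all of these. *)
Lemma commute_sigma (A : 'End(M)) z :
  (forall x, A (sigma rho (- 'i) x) = sigma rho (- 'i) (A x)) ->
  forall x, A (sigma rho z x) = sigma rho z (A x).
Proof.
move=> As x.
have ratio m n : m \in S -> n \in S -> cpow (m / n) ('i * - 'i) = m / n.
  move=> mS nS; rewrite mulrN -expr2 sqrCi opprK cpow1 //.
  by rewrite divr_gt0 ?S_gt0.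
have P k l : k \in S -> l \in S ->
    A (sigma rho z (e k * x * e l)) = sigma rho z (A (e k * x * e l)).
  move=> kS lS; set w := A (e k * x * e l); rewrite sigma_peirce // linearZ /=.
  have := As (e k * x * e l); rewrite sigma_peirce // linearZ /= ratio // -/w => ww.
  apply: (peirce_ext PsiP rho_pos rho_unit) => m n mS nS.
  rewrite eigenproj_sigma // -scalerAr -scalerAl.
  have := congr1 (fun u => e m * u * e n) ww.
  rewrite eigenproj_sigma // ratio // -scalerAr -scalerAl => /eqP.
  rewrite -subr_eq0 -scalerBl scaler_eq0 subr_eq0 => /orP [/eqP -> //|/eqP ->].
  by rewrite !scaler0.
rewrite (peirce_sum PsiP rho_pos rho_unit x) !linear_sum.
apply: eq_big_seq => k kS; rewrite !linear_sum.
by apply: eq_big_seq => l lS; apply: P.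
Qed.

End ModularGroup.

Theorem theorem7p7 (R : realType) (M : cstarAlgType (Cplx R))
    (Psi tau : {scalar M}) (rho : M) (delta : R) (A : 'End(M)) :
  quantum_graph Psi (toC delta) A ->
  density Psi tau rho ->
  (forall v : M,
     2 *: laplacian_L Psi (sigma rho) (toC delta) A v =
     toC delta ^- 2 *: (op_mul (dag Psi A 1) v + op_mul v (A 1)
                        - A v - dag Psi A v)) /\
  (forall v : M,
     2 *: laplacian_R Psi (sigma rho) (toC delta) A v =
     toC delta ^- 2 *: (dag Psi A 1 * v + v * A 1 - A v - dag Psi A v)).
Proof.
move=> G rhoP; have PsiP := qs_faithful (qg_system G).
have s_mod := sigma_modular PsiP rhoP.
split=> v; last exact: laplacian_RE.
apply: laplacian_LE => //.
- exact: sigma_modular_inv PsiP rhoP.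
- exact/(commute_sigma PsiP rhoP)/(modular_commute G).
- exact/(commute_sigma PsiP rhoP)/(modular_commute (quantum_graph_dag G)).
- exact: sigmaM PsiP rhoP _.
- exact: sigma1 PsiP rhoP _.
- exact: Psi_sigma PsiP rhoP _.
- exact: dag_amulr_sigma PsiP rhoP.
Qed.
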